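(* Let $\mathrm{GL}^a(n)$ be the parabolic contraction of $\mathrm{GL}(n,\mathbb F_q)$ with respect to the parabolic subgroup given by the segments $I_1,\dots,I_\ell$. Let $\mathcal A$ be the set of pairs $\alpha=(D,\theta)$, where $D$ is a rook placement in $\Delta(\mathfrak u^a)$ (taken up to the action of $W_L\times W_L$) and $\theta$ is an irreducible character of $H_D$; let $\chi_\alpha$ be the character of $\mathrm{GL}^a(n)$ induced from the character $\sum_{p\in L}\xi_{\theta,p\Lambda_D}$ of the subgroup $G^a_D=H_DU^a_D$. Let $\mathcal B$ be the set of pairs $\beta=(D,h)$, where $D$ is a rook placement in $\Delta(\mathfrak u^a)$ (taken up to the action of $W_L\times W_L$) and $h\in H_D$ (taken up to conjugation in $L$); put $$K_\beta=\mathrm{CL}_L(h)\cdot\bigl(1+\pi_h^{-1}\pi_h(\omega_D)\bigr).$$ Then the system of characters $\{\chi_\alpha:\alpha\in\mathcal A\}$ and the decomposition of the group into the classes $\{K_\beta:\beta\in\mathcal B\}$ give rise to a supercharacter theory of the group $\mathrm{GL}^a(n)$.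
   Context: A supercharacter theory of a finite group $G$ is a pair $(\{\chi_1,\dots,\chi_M\},\{K_1,\dots,K_M\})$, where $\chi_1,\dots,\chi_M$ are pairwise disjoint (no common irreducible constituents) complex characters of $G$, $\{K_1,\dots,K_M\}$ is a partition of $G$ with $\{1\}$ among its members, and every $\chi_i$ is constant on every $K_j$ (the number of characters equals the number of classes). $\mathbb F_q$ is a finite field of $q$ elements of characteristic $\neq 2$; $t\mapsto\varepsilon^t$ is a fixed nontrivial character of $(\mathbb F_q,+)$ with values in $\mathbb C^*$. Write $[1,n]=I_1\sqcup\dots\sqcup I_\ell$ as a union of consecutive segments (in increasing order), $n_i=|I_i|$. All matrices are $n\times n$ over $\mathbb F_q$, with blocks $I_k\times I_m$. $\mathfrak p$ is the algebra of block upper triangular matrices, $\mathfrak u_+$ the strictly block upper triangular matrices, $L=\mathrm{GL}(n_1)\times\dots\times\mathrm{GL}(n_\ell)$ the block diagonal group. $\mathfrak u_-^a$ is the dual space $\mathfrak u_+^*$, identified with the space of strictly block lower triangular matrices via $\lambda(x)=\mathrm{Tr}(\lambda x)$. The associative algebra $\mathfrak{gl}^a(n)=\mathfrak p\oplus\mathfrak u_-^a$ has the matrix multiplication on $\mathfrak p$, zero multiplication on $\mathfrak u_-^a$, and $(t\lambda)(x)=\lambda(xt)$, $(\lambda t)(x)=\lambda(tx)$ for $t\in\mathfrak p$, $\lambda\in\mathfrak u^a_-$, $x\in\mathfrak u_+$. The parabolic contraction $\mathrm{GL}^a(n)$ is the group of invertible elements of $\mathfrak{gl}^a(n)$. $\mathfrak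 u^a=\mathfrak u_+\oplus\mathfrak u_-^a$ is a nilpotent two-sided ideal, $U^a=1+\mathfrak u^a$, and $\mathrm{GL}^a(n)=L\ltimes U^a$. $\mathrm{GL}^a(n)$ acts on $(\mathfrak u^a)^*$ by $(g\Lambda)(X)=\Lambda(Xg)$, $(\Lambda g)(X)=\Lambda(gX)$. $\Delta(\mathfrak u^a)$ is the set of pairs (roots) $(i,j)\in I_k\times I_m$ with $k\ne m$. Those with $k<m$ are positive, with matrix unit $E_{(i,j)}\in\mathfrak u_+$; those with $k>m$ are negative, with matrix unit $F_{(i,j)}\in\mathfrak u_-^a$. These form a basis of $\mathfrak u^a$ with dual basis $E^*_\gamma,F^*_\gamma$. A rook placement is a subset $D$ with at most one element in each row and each column; $D_\pm$ is its set of positive/negative elements. Put $X_D=\sum_{\gamma\in D_+}E_\gamma+\sum_{\gamma\in D_-}F_\gamma$, $\Lambda_D=\sum_{\gamma\in D_+}E^*_\gamma+\sum_{\gamma\in D_-}F^*_\gamma$, and $\omega_D=\mathrm{GL}^a(n)X_D\mathrm{GL}^a(n)$. $W_L=S_{I_1}\times\dots\times S_{I_\ell}$, and $(w_1,w_2)\in W_L\times W_L$ acts on roots by $(i,j)\mapsto(w_1(i),w_2^{-1}(j))$. For $\gamma\in I_k\times I_m$: if $k<m$, $H_\gamma$ is the set of $h=(h_1,\dots,h_\ell)\in L$ such that the submatrix $(h_k,h_{k+1},\dots,h_m)$ is scalar; if $k>m$, $H_\gamma$ is the set of $h\in L$ such that the submatrix $(h_1,\dots,h_m,h_k,\dots,h_\ell)$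 is scalar. $H_D=\bigcap_{\gamma\in D}H_\gamma$ ($H_\varnothing=L$). For $\gamma\in I_k\times I_m$ define $\mathcal S(\gamma)\subset\Delta(\mathfrak u^a)$: if $k<m$, it consists of all roots $\alpha\in I_k\times I_t$ in the same row as $\gamma$ with $k<t<m$; if $k>m$, it consists of all roots $\alpha\in I_k\times I_t$ in the same row as $\gamma$ with $1\le t<m$ or $k<t\le\ell$. $\mathfrak u^a_D$ is the span of the matrix units $E_\beta,F_\beta$ with $\beta\notin\bigcup_{\gamma\in D}\mathcal S(\gamma)$, and $U^a_D=1+\mathfrak u^a_D$. For $p\in L$, $\xi_{\theta,p\Lambda_D}(hu)=\theta(h)\varepsilon^{(p\Lambda_D)(X)}$, where $h\in H_D$, $u=1+X$, $X\in\mathfrak u^a_D$; this is a character of $G_D^a$. For $h\in L$, $\mathfrak u^a_h$ is the smallest ideal of $\mathfrak u^a$ invariant under left and right multiplication by $\mathrm{GL}^a(n)$ such that $\mathrm{Ad}_h: X\mapsto hXh^{-1}$ is the identity on $\mathfrak u^a/\mathfrak u^a_h$; $\pi_h:\mathfrak u^a\to\mathfrak u^a/\mathfrak u_h^a$ is the natural projection. $\mathrm{CL}_L(h)$ is the conjugacy class of $h$ in $L$. *)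

(* Defs.v *)
From HB Require Import structures.
From mathcomp Require Import all_boot all_order all_algebra all_fingroup.
From mathcomp Require Import all_solvable all_field all_character.

Set Implicit Arguments.
Unset Strict Implicit.
Unset Printing Implicit Defensive.

From mathcomp Require Import zify.

Import GRing.Theory.
Local Open Scope ring_scope.

(* [Xs] and [Ks] list chi_1, ..., chi_M and K_1, ..., K_M. In MathComp 0 counts
   as a character, hence the extra condition [chi != 0]. *)

Definition disjoint_characters (gT : finGroupType) (G : {group gT})
    (phi psi : 'CF(G)) : bool :=
  [disjoint irr_constt phi & irr_constt psi].

Definition supercharacter_theory (gT : finGroupType) (G : {group gT})
    (Xs : seq 'CF(G)) (Ks : seq {set gT}) : Prop :=
  [/\ (forall chi, chi \in Xs -> chi \is a character /\ chi != 0)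
        /\ pairwise (@disjoint_characters gT G) Xs,
      uniq Ks /\ partition [set:: Ks] G,
      [set 1%g] \in Ks,
      size Xs = size Ks
    & forall chi K, chi \in Xs -> K \in Ks ->
        {in K &, forall x y, chi x = chi y}].

(* Characters t |-> eps^t of the additive group of F; their values are roots of
   unity, so algC serves as the field of complex numbers. *)
Record addchar (F : finFieldType) := AddChar {
  addchar_fun :> F -> algC;
  addchar0 : addchar_fun 0 = 1;
  addcharD : {morph addchar_fun : s t / s + t >-> s * t} }.

(* The segments I_1, ..., I_l of {0, ..., n} are the fibres of a map
   b : 'I_n.+1 -> 'I_l; monotonicity and surjectivity of b play no role in the
   definitions.
   An element (p, lambda) of gl^a = p (+) u_-^a is stored as the single matrix
   p + lambda, lambda being identified with a strictly block lower triangular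
   matrix through lambda(x) = Tr(lambda x). *)
Record gla (F : finFieldType) (n l : nat) (b : 'I_n.+1 -> 'I_l) :=
  Gla { gla_mx :> 'M[F]_n.+1 }.
Arguments Gla {F n l} b gla_mx.
Arguments gla F {n l} b.

HB.instance Definition _ (F : finFieldType) (n l : nat) (b : 'I_n.+1 -> 'I_l) :=
  [isNew for @gla_mx F n l b].
HB.instance Definition _ (F : finFieldType) (n l : nat) (b : 'I_n.+1 -> 'I_l) :=
  [Finite of gla F b by <:].

Section Algebra.

Variables (F : finFieldType) (n l : nat) (b : 'I_n.+1 -> 'I_l).
Local Notation M := 'M[F]_n.+1.
Local Notation A := (gla F b).
Implicit Types (x y z : M) (X Y Z : A).

(* Components along p and along u_-^a. *)
Definition up x : M := \matrix_(i, j) (if (b i <= b j)%N then x i j else 0).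
Definition lo x : M := \matrix_(i, j) (if (b j < b i)%N then x i j else 0).

(* (t lambda)(x) = lambda(x t) = Tr(t lambda x) and
   (lambda t)(x) = lambda(t x) = Tr(lambda t x) for x in u_+ only see the
   strictly block lower triangular parts of t lambda and lambda t. *)
Definition lmodmx (t lam : M) : M := lo (t *m lam).
Definition rmodmx (lam t : M) : M := lo (lam *m t).

Lemma tr_lo x y : (forall i j, (b j <= b i)%N -> y i j = 0) ->
  \tr (lo x *m y) = \tr (x *m y).
Proof.
move=> y_up; apply: eq_bigr => i _; rewrite !mxE; apply: eq_bigr => j _.
by rewrite mxE ltnNge; case: leqP => // le_ij; rewrite (y_up j i) ?mulr0.
Qed.

Lemma lmodmxE t lam x : (forall i j, (b j <= b i)%N -> x i j = 0) ->
  \tr (lmodmx t lam *m x) = \tr (lam *m (x *m t)).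
Proof. by move=> x_up; rewrite tr_lo // -mulmxA mxtrace_mulC mulmxA. Qed.

Lemma rmodmxE lam t x : (forall i j, (b j <= b i)%N -> x i j = 0) ->
  \tr (rmodmx lam t *m x) = \tr (lam *m (t *m x)).
Proof. by move=> x_up; rewrite tr_lo // mulmxA. Qed.

Definition gla_mul X Y : A :=
  Gla b (up X *m up Y + (lmodmx (up X) (lo Y) + rmodmx (lo X) (up Y))).

Lemma upDlo x : up x + lo x = x.
Proof.
by apply/matrixP=> i j; rewrite !mxE ltnNge; case: leqP => _ /=; rewrite ?addr0 ?add0r.
Qed.
Lemma upD : {morph up : x y / x + y}.
Proof. by move=> x y; apply/matrixP=> i j; rewrite !mxE; case: ifP; rewrite ?addr0. Qed.
Lemma lo0 : lo 0 = 0.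
Proof. by apply/matrixP=> i j; rewrite !mxE; case: ifP. Qed.
Lemma loD : {morph lo : x y / x + y}.
Proof. by move=> x y; apply/matrixP=> i j; rewrite !mxE; case: ifP; rewrite ?addr0. Qed.
Lemma upK x : up (up x) = up x.
Proof. by apply/matrixP=> i j; rewrite !mxE; case: (_ <= _)%N. Qed.
Lemma loK x : lo (lo x) = lo x.
Proof. by apply/matrixP=> i j; rewrite !mxE; case: (_ < _)%N. Qed.
Lemma lo_up x : lo (up x) = 0.
Proof. by apply/matrixP=> i j; rewrite !mxE ltnNge; case: leqP. Qed.
Lemma up_lo x : up (lo x) = 0.
Proof. by apply/matrixP=> i j; rewrite !mxE ltnNge; case: leqP. Qed.
Lemma up_mul x y : up (up x *m up y) = up x *m up y.
Proof.
apply/matrixP=> i j; rewrite !mxE; case: leqP => // lt_ji.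
apply/esym/big1 => k _; rewrite !mxE; case: leqP => le_ik; last by rewrite mul0r.
by rewrite leqNgt (leq_trans lt_ji) ?mulr0.
Qed.
Lemma lo_mul x y : lo (up x *m up y) = 0.
Proof. by rewrite -up_mul lo_up. Qed.
Lemma lo_mulr x y : lo (up x *m lo y) = lo (up x *m y).
Proof. by rewrite -{2}(upDlo y) mulmxDr loD lo_mul add0r. Qed.
Lemma lo_mull x y : lo (lo x *m up y) = lo (x *m up y).
Proof. by rewrite -{2}(upDlo x) mulmxDl loD lo_mul add0r. Qed.
Lemma up1 : up 1%:M = 1%:M.
Proof.
apply/matrixP=> i j; rewrite !mxE; case: leqP => // lt_ji.
by case: eqP => // eq_ij; rewrite eq_ij ltnn in lt_ji.
Qed.
Lemma lo1 : lo 1%:M = 0.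
Proof. by rewrite -up1 lo_up. Qed.
Lemma up_glaM X Y : up (gla_mul X Y) = up X *m up Y.
Proof. by rewrite /= !upD up_mul !up_lo !addr0. Qed.
Lemma lo_glaM X Y : lo (gla_mul X Y) = lo (up X *m lo Y + lo X *m up Y).
Proof. by rewrite /= !loD lo_mul !loK add0r. Qed.

Lemma gla_eqP X Y : up X = up Y -> lo X = lo Y -> X = Y.
Proof. by move=> eU eL; apply: val_inj; rewrite /= -(upDlo X) -(upDlo Y) eU eL. Qed.

Definition gla_add X Y : A := Gla b (gla_mx X + gla_mx Y).
Definition gla_opp X : A := Gla b (- gla_mx X).
Definition gla_scale (c : F) X : A := Gla b (c *: gla_mx X).

Fact gla_addA : associative gla_add.
Proof. by move=> X Y Z; apply: val_inj; exact: addrA. Qed.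
Fact gla_addC : commutative gla_add.
Proof. by move=> X Y; apply: val_inj; exact: addrC. Qed.
Fact gla_add0 : left_id (Gla b 0) gla_add.
Proof. by move=> X; apply: val_inj; exact: add0r. Qed.
Fact gla_addN : left_inverse (Gla b 0) gla_opp gla_add.
Proof. by move=> X; apply: val_inj; exact: addNr. Qed.

HB.instance Definition _ :=
  GRing.isZmodule.Build A gla_addA gla_addC gla_add0 gla_addN.

Fact gla_mulA : associative gla_mul.
Proof.
move=> X Y Z; apply: gla_eqP; first by rewrite !up_glaM mulmxA.
rewrite !lo_glaM !up_glaM.
rewrite [LHS]loD -[in LHS](up_mul Y Z) lo_mulr lo_mull up_mul.
rewrite [RHS]loD -[in RHS](up_mul X Y) lo_mulr lo_mull up_mul.
have -> : lo (X *m (up Y *m up Z)) = lo (lo X *m (up Y *m up Z)).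
  by rewrite -[in LHS](upDlo X) mulmxDl loD -[up Y *m _]up_mul lo_mul add0r.
have -> : lo (up X *m up Y *m Z) = lo (up X *m up Y *m lo Z).
  by rewrite -[in LHS](upDlo Z) mulmxDr loD -[up X *m _]up_mul lo_mul add0r.
by rewrite mulmxDr mulmxDl !loD !mulmxA -!addrA.
Qed.
Fact gla_mul1l : left_id (Gla b 1%:M) gla_mul.
Proof.
move=> X; apply: val_inj => /=.
by rewrite up1 lo1 /rmodmx mul0mx /lmodmx !mul1mx loK lo0 addr0 upDlo.
Qed.
Fact gla_mul1r : right_id (Gla b 1%:M) gla_mul.
Proof.
move=> X; apply: val_inj => /=.
by rewrite up1 lo1 /lmodmx mulmx0 /rmodmx !mulmx1 loK lo0 add0r upDlo.
Qed.
Fact gla_mulDl : left_distributive gla_mul +%R.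
Proof.
move=> X Y Z; apply: val_inj => /=.
rewrite /lmodmx /rmodmx !upD !loD !mulmxDl !loD.
by rewrite [X in _ + X = _]addrACA [LHS]addrACA.
Qed.
Fact gla_mulDr : right_distributive gla_mul +%R.
Proof.
move=> X Y Z; apply: val_inj => /=.
rewrite /lmodmx /rmodmx !upD !loD !mulmxDr !loD.
by rewrite [X in _ + X = _]addrACA [LHS]addrACA.
Qed.
Fact gla_nz1 : Gla b 1%:M != 0 :> A.
Proof. by rewrite -val_eqE /= oner_eq0. Qed.

HB.instance Definition _ := GRing.Zmodule_isNzRing.Build A
  gla_mulA gla_mul1l gla_mul1r gla_mulDl gla_mulDr gla_nz1.

Fact gla_scaleA (c d : F) X : gla_scale c (gla_scale d X) = gla_scale (c * d) X.
Proof. by apply: val_inj; exact: scalerA. Qed.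
Fact gla_scale1 : left_id 1 gla_scale.
Proof. by move=> X; apply: val_inj; exact: scale1r. Qed.
Fact gla_scaleDr : right_distributive gla_scale +%R.
Proof. by move=> c X Y; apply: val_inj; exact: scalerDr. Qed.
Fact gla_scaleDl X : {morph gla_scale^~ X : c d / c + d}.
Proof. by move=> c d; apply: val_inj; exact: scalerDl. Qed.

HB.instance Definition _ := GRing.Zmodule_isLmodule.Build F A
  gla_scaleA gla_scale1 gla_scaleDr gla_scaleDl.

Lemma upZ (c : F) x : up (c *: x) = c *: up x.
Proof. by apply/matrixP=> i j; rewrite !mxE; case: ifP; rewrite ?mulr0. Qed.
Lemma loZ (c : F) x : lo (c *: x) = c *: lo x.
Proof. by apply/matrixP=> i j; rewrite !mxE; case: ifP; rewrite ?mulr0. Qed.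
Fact gla_scalerAl (c : F) X Y : c *: (X * Y) = (c *: X) * Y.
Proof.
apply: val_inj => /=.
by rewrite upZ loZ /lmodmx /rmodmx -!scalemxAl !loZ !scalerDr.
Qed.
Fact gla_scalerAr (c : F) X Y : c *: (X * Y) = X * (c *: Y).
Proof.
apply: val_inj => /=.
by rewrite upZ loZ /lmodmx /rmodmx -!scalemxAr !loZ !scalerDr.
Qed.

HB.instance Definition _ :=
  GRing.Lmodule_isLalgebra.Build F A gla_scalerAl.
HB.instance Definition _ :=
  GRing.Lalgebra_isAlgebra.Build F A gla_scalerAr.

HB.instance Definition _ := FinRing.isNzRing.Build A.


End Algebra.

Section Contraction.

Variables (F : finFieldType) (n l : nat) (b : 'I_n.+1 -> 'I_l).
Local Notation A := (gla F b).
Local Notation gT := {unit gla F b}.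
Local Notation root := ('I_n.+1 * 'I_n.+1)%type.
Implicit Types (X Y Z : A) (g h p u : gT) (D : {set root}) (gam : root).

(* The order on blocks 0, ..., l-1 unrolled cyclically from k. *)
Definition cyc (k t m : nat) : bool :=
  if (k <= m)%N then (k <= t)%N && (t <= m)%N else (k <= t)%N || (t <= m)%N.

Lemma glaME X Y i j :
  (X * Y) i j = \sum_(s | cyc (b i) (b s) (b j)) X i s * Y s j.
Proof.
rewrite [RHS]big_mkcond /= -up_mul !mxE /cyc !(ltnNge (b j)).
case: (leqP (b i) (b j)) => [le_ij | lt_ji] /=.
  rewrite !addr0; apply: eq_bigr => s _; rewrite !mxE.
  by case: (_ <= _)%N; case: (_ <= _)%N; rewrite ?mulr0 ?mul0r.
rewrite add0r -big_split /=; apply: eq_bigr => s _; rewrite !mxE !ltnNge.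
case: (leqP (b i) (b s)) => [le_is | lt_si]; case: (leqP (b s) (b j)) => [le_sj|lt_js] /=.
- by have:= leq_ltn_trans (leq_trans le_is le_sj) lt_ji; rewrite ltnn.
all: by rewrite ?mul0r ?mulr0 ?addr0 ?add0r.
Qed.

(* GL^a(n) is {unit gla F b}; its block diagonal elements form the subgroup
   L = GL(n_1) x ... x GL(n_l). *)
Definition Lset : {set gT} :=
  [set g : gT | [forall i, forall j, (b i != b j) ==> (gla_mx (val g) i j == 0)]].

(* u^a = u_+ (+) u_-^a, the elements with zero diagonal blocks. *)
Definition ua : {set A} :=
  [set X : A | [forall i, forall j, (b i == b j) ==> (X i j == 0)]].

(* Delta(u^a), with I_k x I_m positive for k < m, negative for k > m. *)
Definition roots : {set root} := [set gam : root | b gam.1 != b gam.2].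

Definition rook_placement D : bool :=
  [&& D \subset roots, dinjectiveb (fun gam => gam.1) D
    & dinjectiveb (fun gam => gam.2) D].

(* The matrix unit E_gam or F_gam, according to the sign of gam. *)
Definition root_vec gam : A := Gla b (delta_mx gam.1 gam.2).

Definition X_ D : A := \sum_(gam in D) root_vec gam.

(* Elements of the dual of u^a are represented by functions on gl^a, of which
   only the values on u^a matter. *)
Definition Lambda D : A -> F := fun X => \sum_(gam in D) X gam.1 gam.2.

Definition lact g (Lam : A -> F) : A -> F := fun X => Lam (X * val g).

Definition omega D : {set A} :=
  [set val g * X_ D * val g' | g in [set: gT], g' in [set: gT]].

(* W_L, and the action (i, j) |-> (w1 i, w2^-1 j) on roots. *)
Definition WL : {set 'S_n.+1} := [set w : 'S_n.+1 | [forall i, b (w i) == b i]].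

Definition Wact (w1 w2 : 'S_n.+1) D : {set root} :=
  [set (w1 gam.1, (w2^-1)%g gam.2) | gam in D].

Definition Wequiv D D' : bool :=
  [exists w1 in WL, exists w2 in WL, D' == Wact w1 w2 D].

(* The blocks k, k+1, ..., m if k < m, and 1, ..., m, k, ..., l if k > m. *)
Definition arc gam (t : 'I_l) : bool :=
  if (b gam.1 < b gam.2)%N then (b gam.1 <= t)%N && (t <= b gam.2)%N
  else (t <= b gam.2)%N || (b gam.1 <= t)%N.

Definition Hroot gam : {set gT} :=
  [set h : gT in Lset | [exists c : F, forall i, forall j,
     arc gam (b i) && arc gam (b j) ==> (gla_mx (val h) i j == c *+ (i == j))]].

Definition HD D : {set gT} := Lset :&: \bigcap_(gam in D) Hroot gam.

Definition Sroot gam : {set root} :=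
  [set al : root in roots | (al.1 == gam.1) &&
     (if (b gam.1 < b gam.2)%N
      then (b gam.1 < b al.2)%N && (b al.2 < b gam.2)%N
      else (b al.2 < b gam.2)%N || (b gam.1 < b al.2)%N)].

(* The span of the matrix units at the roots outside of the S(gam), gam in D,
   cut out by the vanishing of the other coordinates. *)
Definition uD D : {set A} :=
  [set X : A in ua | [forall be in \bigcup_(gam in D) Sroot gam,
                    X be.1 be.2 == 0]].

Definition UD D : {set gT} := [set g : gT | val g - 1 \in uD D].

Definition GD D : {set gT} := (HD D * UD D)%g.

Lemma LsetP g :
  reflect (forall i j, b i != b j -> gla_mx (val g) i j = 0) (g \in Lset).
Proof.
rewrite inE; apply: (iffP idP) => [/forallP Lg i j | Lg].
  by move/forallP/(_ j)/implyP: (Lg i) => Lgij /Lgij/eqP.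
by apply/forallP=> i; apply/forallP=> j; apply/implyP=> /Lg->.
Qed.

Lemma uaP X : reflect (forall i j, b i = b j -> X i j = 0) (X \in ua).
Proof.
rewrite inE; apply: (iffP idP) => [/forallP Xu i j /eqP | Xu].
  by move/forallP/(_ j)/implyP: (Xu i) => Xij /Xij/eqP.
by apply/forallP=> i; apply/forallP=> j; apply/implyP=> /eqP/Xu->.
Qed.

Lemma cyc_l k m : cyc k k m.
Proof. by rewrite /cyc leqnn /=; case: leqP. Qed.
Lemma cyc_r k m : cyc k m m.
Proof. by rewrite /cyc leqnn /= orbT andbT; case: leqP. Qed.
Lemma cyc_id k t : cyc k t k -> t = k.
Proof. by rewrite /cyc leqnn -eqn_leq => /eqP. Qed.

Lemma mulL_r X g i j : g \in Lset ->
  (X * val g) i j = \sum_(s | b s == b j) X i s * gla_mx (val g) s j.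
Proof.
move/LsetP=> Lg; rewrite glaME big_mkcond [RHS]big_mkcond /=.
apply: eq_bigr => s _; case: eqP => [-> | /eqP ne_sj]; first by rewrite cyc_r.
by rewrite Lg // mulr0 if_same.
Qed.
Lemma mulL_l X g i j : g \in Lset ->
  (val g * X) i j = \sum_(s | b s == b i) gla_mx (val g) i s * X s j.
Proof.
move/LsetP=> Lg; rewrite glaME big_mkcond [RHS]big_mkcond /=.
apply: eq_bigr => s _; case: eqP => [-> | /eqP ne_sj]; first by rewrite cyc_l.
by rewrite Lg 1?eq_sym // mul0r if_same.
Qed.

Lemma gla1E i j : (1 : A) i j = (i == j)%:R.
Proof. by rewrite mxE. Qed.
Lemma gla0E i j : (0 : A) i j = 0.
Proof. by rewrite mxE. Qed.
Lemma glaDE X Y i j : (X + Y) i j = X i j + Y i j.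
Proof. by rewrite mxE. Qed.
Lemma glaNE X i j : (- X) i j = - X i j.
Proof. by rewrite mxE. Qed.

Fact Lset_group_set : group_set Lset.
Proof.
apply/group_setP; split=> [|g h Lg Lh]; apply/LsetP=> i j ne_ij.
  by rewrite FinRing.val_unit1 gla1E; case: (i =P j) ne_ij => [->|]; rewrite ?eqxx.
rewrite FinRing.val_unitM mulL_r // big1 // => s /eqP e_sj.
by rewrite (LsetP _ Lg) ?mul0r ?e_sj.
Qed.
Canonical L_group := Group Lset_group_set.


Lemma HrootP gam h : reflect
  (h \in Lset /\ exists c : F, forall i j, arc gam (b i) -> arc gam (b j) ->
     gla_mx (val h) i j = c *+ (i == j)) (h \in Hroot gam).
Proof.
apply: (iffP setIdP) => -[Lh hc]; split=> //.
  have [c hc'] := existsP hc; exists c => i j ai aj.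
  by have /forallP/(_ j) := forallP hc' i; rewrite ai aj => /eqP.
have [c hc'] := hc; apply/existsP; exists c; apply/forallP=> i; apply/forallP=> j.
by apply/implyP=> /andP[ai aj]; rewrite hc'.
Qed.

Fact Hroot_group_set gam : group_set (Hroot gam).
Proof.
apply/group_setP; split=> [|g h /HrootP[Lg [c gc]] /HrootP[Lh [d hd]]].
  apply/HrootP; split; first exact: group1.
  by exists 1 => i j _ _; rewrite FinRing.val_unit1 gla1E.
apply/HrootP; split; first exact: groupM.
exists (c * d) => i j ai aj; rewrite FinRing.val_unitM mulL_r //.
rewrite (bigD1 j) //= big1 ?addr0 => [|s /andP[/eqP e_sj /negPf ne_sj]].
  by rewrite gc // hd // eqxx mulrnAl.
by rewrite hd // ?e_sj // ne_sj mulr0.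
Qed.
Canonical Hroot_group gam := Group (Hroot_group_set gam).

Canonical HD_group D := Eval hnf in [group of HD D].

Lemma HDP D h gam : h \in HD D -> gam \in D -> h \in Lset /\
  exists c : F, forall i j, arc gam (b i) -> arc gam (b j) ->
     gla_mx (val h) i j = c *+ (i == j).
Proof. by case/setIP=> _ /bigcapP Hh /Hh/HrootP. Qed.

Lemma arc_l gam : arc gam (b gam.1).
Proof. by rewrite /arc leqnn orbT; case: ifP => // /ltnW. Qed.
Lemma arc_r gam : arc gam (b gam.2).
Proof. by rewrite /arc leqnn andbT; case: ifP => // /ltnW. Qed.

Lemma uDP D X : reflect ((forall i j, b i = b j -> X i j = 0) /\
  forall gam al, gam \in D -> al \in Sroot gam -> X al.1 al.2 = 0) (X \in uD D).
Proof.
apply: (iffP setIdP) => [[/uaP Xu /forall_inP XD]|[Xu XD]]; split=> //.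
- by move=> gam al Dg Sa; apply/eqP/XD/bigcupP; exists gam.
- exact/uaP.
- by apply/forall_inP=> al /bigcupP[gam Dg Sa]; apply/eqP/(XD gam).
Qed.

Lemma cyc_strict (k s m : nat) : s != k -> s != m -> cyc k s m ->
  if (k < m)%N then (k < s)%N && (s < m)%N else (s < m)%N || (k < s)%N.
Proof.
rewrite /cyc => /eqP ? /eqP ?.
by case: (ltngtP k m) => ? /=; lia.
Qed.

Lemma cyc_strict_trans (k s t m : nat) : s != k -> t != k -> cyc k s t ->
  (if (k < m)%N then (k < t)%N && (t < m)%N else (t < m)%N || (k < t)%N) ->
  if (k < m)%N then (k < s)%N && (s < m)%N else (s < m)%N || (k < s)%N.
Proof.
rewrite /cyc => /eqP ? /eqP ?.
by case: (ltnP k m) => ?; case: (leqP k t) => ? /=; lia.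
Qed.

Lemma Sroot_cyc gam s : b s != b gam.1 -> b s != b gam.2 ->
  cyc (b gam.1) (b s) (b gam.2) -> (gam.1, s) \in Sroot gam.
Proof.
move=> ne1 ne2 cs; apply/setIdP; rewrite inE /= eqxx eq_sym.
by split; last exact: cyc_strict.
Qed.

Lemma Sroot_trans gam al s : al \in Sroot gam -> b s != b gam.1 ->
  cyc (b gam.1) (b s) (b al.2) -> (gam.1, s) \in Sroot gam.
Proof.
case/setIdP; rewrite inE => ne_al /andP[/eqP e1 Sal] ne_s cs.
apply/setIdP; rewrite inE /= eqxx eq_sym; split=> //.
by apply: cyc_strict_trans Sal => //; rewrite -e1 eq_sym.
Qed.

Lemma uD0 D : 0 \in uD D.
Proof. by apply/uDP; split=> *; rewrite gla0E. Qed.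

Lemma uDD D X Y : X \in uD D -> Y \in uD D -> X + Y \in uD D.
Proof.
case/uDP=> Xu XD /uDP[Yu YD].
apply/uDP; split=> [i j e_ij | gam al Dg Sa]; rewrite glaDE.
  by rewrite Xu // Yu // addr0.
by rewrite (XD gam) // (YD gam) // addr0.
Qed.

Lemma ua_mulr X Y : X \in ua -> X * Y \in ua.
Proof.
move/uaP=> Xu; apply/uaP=> i j e_ij; rewrite glaME big1 // => s.
by rewrite e_ij => /cyc_id/val_inj e_s; rewrite Xu ?mul0r ?e_ij.
Qed.

(* u^a_D is a right ideal of gl^a. *)
Lemma uD_mulr D X Y : X \in uD D -> X * Y \in uD D.
Proof.
move=> XuD; have [Xu XD] := uDP _ _ XuD.
have /uaP XYu : X * Y \in ua by apply/ua_mulr/uaP.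
apply/uDP; split=> // gam al Dg Sa; rewrite glaME big1 // => s.
have e1 : al.1 = gam.1 by case/setIdP: Sa => _ /andP[/eqP].
rewrite e1 => cs; have [e_s | ne_s] := eqVneq (b s) (b gam.1).
  by rewrite Xu ?mul0r.
by rewrite (XD gam (gam.1, s)) ?mul0r //; apply: Sroot_trans cs.
Qed.

Lemma HD_row D h X gam : h \in HD D -> gam \in D -> exists c : F, forall j,
  (val h * X) gam.1 j = c * X gam.1 j.
Proof.
move=> Hh Dg; have [Lh [c hc]] := HDP Hh Dg; exists c => j.
rewrite mulL_l // (bigD1 gam.1) //= big1 ?addr0 => [|s /andP[/eqP e_s ne_s]].
  by rewrite hc ?arc_l // eqxx.
by rewrite hc ?e_s ?arc_l // eq_sym (negPf ne_s) mul0r.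
Qed.

Lemma uD_mull D h X : h \in HD D -> X \in uD D -> val h * X \in uD D.
Proof.
move=> Hh /uDP[Xu XD]; have Lh : h \in Lset by case/setIP: Hh.
apply/uDP; split=> [i j e_ij | gam al Dg Sa].
  by rewrite mulL_l // big1 // => s /eqP e_s; rewrite Xu ?mulr0 ?e_s.
have e1 : al.1 = gam.1 by case/setIdP: Sa => _ /andP[/eqP].
have [c hc] := HD_row X Hh Dg; rewrite e1 hc -e1 (XD gam al) ?mulr0 //.
Qed.

Lemma UDE D g : (g \in UD D) = (val g - 1 \in uD D).
Proof. by rewrite inE. Qed.

Fact UD_group_set D : group_set (UD D).
Proof.
apply/group_setP; split=> [|g h].
  by rewrite UDE FinRing.val_unit1 subrr uD0.
rewrite !UDE FinRing.val_unitM => Ug Uh.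
have -> : val g * val h - 1 = (val g - 1) * val h + (val h - 1).
  by rewrite mulrBl mul1r addrA subrK.
by rewrite uDD ?uD_mulr.
Qed.
Canonical UD_group D := Group (UD_group_set D).

Lemma val_unitJ g h : val (g ^ h)%g - 1 = val h^-1%g * (val g - 1) * val h.
Proof.
rewrite /conjg !FinRing.val_unitM mulrBr mulrBl mulr1 mulrA.
by rewrite FinRing.val_unitV mulVr ?(valP h).
Qed.

Lemma HD_norm_UD D : HD D \subset 'N(UD D)%g.
Proof.
apply/subsetP=> h Hh; rewrite inE; apply/subsetP=> _ /imsetP[u Uu ->].
rewrite UDE val_unitJ uD_mulr // uD_mull ?groupV //.
by rewrite -UDE.
Qed.

Lemma HD_UD_trivg D : (HD D :&: UD D)%g = 1%g.
Proof.
apply/trivgP/subsetP=> g /setIP[/setIP[/LsetP Lg _]].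
rewrite UDE => /uDP[Ug _]; apply/set1P/val_inj/val_inj/matrixP=> i j.
rewrite FinRing.val_unit1 [RHS]gla1E; have [e_ij | ne_ij] := eqVneq (b i) (b j).
  by move/eqP: (Ug i j e_ij); rewrite glaDE glaNE gla1E subr_eq0 => /eqP.
by rewrite [LHS]Lg //; case: (i =P j) ne_ij => [->|]; rewrite ?eqxx.
Qed.

Fact GD_group_set D : group_set (GD D).
Proof. by rewrite /GD -norm_joinEl ?HD_norm_UD ?groupP. Qed.
Canonical GD_group D := Group (GD_group_set D).

Lemma Lambda_HD D h X p : h \in HD D -> X \in uD D ->
  Lambda D (val h * X * val p) = Lambda D (X * val h * val p).
Proof.
move=> Hh XuD; apply: eq_bigr => gam Dg; have [Lh [c hc]] := HDP Hh Dg.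
have hrow Y : (val h * Y) gam.1 gam.2 = c * Y gam.1 gam.2.
  rewrite mulL_l // (bigD1 gam.1) //= big1 ?addr0 => [|s /andP[/eqP e_s ne_s]].
    by rewrite hc ?arc_l // eqxx.
  by rewrite hc ?e_s ?arc_l // eq_sym (negPf ne_s) mul0r.
have [/uDP[Xu XD] /uDP[Xhu XhD]] := (XuD, uD_mulr (val h) XuD).
rewrite -mulrA hrow !glaME mulr_sumr; apply: eq_bigr => s cs.
have [e1 | ne1] := eqVneq (b s) (b gam.1).
  by rewrite Xu // Xhu // !(mul0r, mulr0).
have [e2 | ne2] := eqVneq (b s) (b gam.2); last first.
  by rewrite (XD gam (gam.1, s)) ?(XhD gam (gam.1, s)) ?(mul0r, mulr0) ?Sroot_cyc.
rewrite mulL_r // (bigD1 s) //= big1 ?addr0 => [|t /andP[/eqP e_t ne_t]].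
  by rewrite hc ?e2 ?arc_r // eqxx mulrA [c * _]mulrC.
by rewrite hc ?e_t ?e2 ?arc_r // (negPf ne_t) mulr0.
Qed.

Lemma Lambda_uDM D X Y : X \in uD D -> Y \in ua -> Lambda D (X * Y) = 0.
Proof.
case/uDP=> Xu XD /uaP Yu; apply: big1 => gam Dg; rewrite glaME big1 // => s cs.
have [e1 | ne1] := eqVneq (b s) (b gam.1); first by rewrite Xu ?mul0r.
have [e2 | ne2] := eqVneq (b s) (b gam.2); first by rewrite Yu ?mulr0.
by rewrite (XD gam (gam.1, s)) ?mul0r ?Sroot_cyc.
Qed.

Lemma LambdaD D X Y : Lambda D (X + Y) = Lambda D X + Lambda D Y.
Proof. by rewrite -big_split /=; apply: eq_bigr => gam _; rewrite glaDE. Qed.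

Definition mu D p u : F := lact p (Lambda D) (val u - 1).

Lemma mu_M D p u u' : u \in UD D -> u' \in UD D ->
  mu D p (u * u')%g = mu D p u + mu D p u'.
Proof.
rewrite !UDE => Uu Uu'; rewrite /mu /lact FinRing.val_unitM.
have -> : val u * val u' - 1 =
    (val u - 1) * (val u' - 1) + ((val u - 1) + (val u' - 1)).
  rewrite [_ * (_ - _)]mulrBr mulr1 subrKA mulrBl mul1r.
  by rewrite addrA subrK.
rewrite mulrDl LambdaD -mulrA Lambda_uDM ?add0r ?mulrDl ?LambdaD //.
by rewrite -mulrDl; case/uDP: Uu' => Xu _; apply/ua_mulr/uaP.
Qed.

Lemma mu_J D p h u : h \in HD D -> u \in UD D -> mu D p (u ^ h)%g = mu D p u.
Proof.
move=> Hh Uu; rewrite UDE in Uu; rewrite /mu /lact val_unitJ.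
rewrite -Lambda_HD ?uD_mull ?groupV // FinRing.val_unitV !mulrA.
by rewrite mulrV ?(valP h) // mul1r.
Qed.

Variable eps : addchar F.

(* xi_{theta, p Lambda_D}; the factors of g = h u in G^a_D = H_D U^a_D are
   [divgr] and [remgr]. *)
Definition xi_fun D (theta : 'CF(HD D)) p g : algC :=
  if g \in GD D then
    theta (divgr (HD D) (UD D) g) * eps (mu D p (remgr (HD D) (UD D) g))
  else 0.

Lemma xi_funE D (theta : 'CF(HD D)) p h u : h \in HD D -> u \in UD D ->
  xi_fun theta p (h * u)%g = theta h * eps (lact p (Lambda D) (val u - 1)).
Proof.
move=> Hh Uu; rewrite /xi_fun mem_mulg //.
by rewrite divgrMid ?remgrMid ?HD_UD_trivg.
Qed.

Fact xi_subproof D (theta : 'CF(HD D)) p :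
  is_class_fun <<GD D>>%g (finfun (xi_fun theta p)).
Proof.
rewrite genGid; apply: intro_class_fun => [g g'|g]; last first.
  by rewrite /xi_fun => /negPf->.
case/mulsgP=> h u Hh Uu -> /mulsgP[k v Hk Uv ->].
have nU x : x \in HD D -> forall y, y \in UD D -> (y ^ x)%g \in UD D.
  by move=> Hx y Uy; rewrite memJ_norm // (subsetP (HD_norm_UD D)).
pose w := ((v^-1) ^ (h ^ k) * (u ^ k * v))%g.
have -> : ((h * u) ^ (k * v) = h ^ k * w)%g.
  by rewrite conjgM [((h * u) ^ k)%g]conjMg /w [RHS]mulgA -conjgC [LHS]/conjg !mulgA.
have Hhk : (h ^ k)%g \in HD D by rewrite groupJ.
have Uw : w \in UD D by apply: groupM; [apply: nU; rewrite ?groupV | apply/groupM/Uv/nU].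
rewrite !xi_funE // cfunJ //; congr (_ * eps _).
have mu_V x : x \in UD D -> mu D p x^-1%g = - mu D p x.
  move=> Ux; apply/eqP; rewrite -addr_eq0 -mu_M ?groupV // mulVg.
  by rewrite /mu /lact FinRing.val_unit1 subrr mul0r /Lambda big1 // => *; rewrite gla0E.
rewrite -!/(mu _ _ _) mu_M ?(nU, groupM, groupV) //.
rewrite [mu D p (u ^ k * v)]mu_M ?nU // !mu_J ?groupV // mu_V //.
by rewrite addrCA addNr addr0.
Qed.

Definition xi D (theta : 'CF(HD D)) p : 'CF(GD D) :=
  Cfun 0 (xi_subproof theta p).

Lemma xiE D (theta : 'CF(HD D)) p h u : h \in HD D -> u \in UD D ->
  xi theta p (h * u)%g = theta h * eps (lact p (Lambda D) (val u - 1)).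
Proof. by move=> Hh Uu; rewrite cfunE xi_funE. Qed.

(* Pairs (D, theta); theta is given by its index in irr (HD D). *)
Definition charIndex : finType := {D : {set root} & Iirr (HD D)}.

Definition chi (alpha : charIndex) : 'CF([set: gT]) :=
  'Ind[[set: gT]] (\sum_(p in Lset) xi 'chi_(tagged alpha) p).

(* H_D and H_{w(D)} coincide as sets for w in W_L x W_L, so their characters are
   compared as functions on GL^a(n). *)
Definition char_equiv : rel charIndex := fun alpha alpha' =>
  Wequiv (tag alpha) (tag alpha') &&
  [forall g : gT, 'chi_(tagged alpha) g == 'chi_(tagged alpha') g].

Definition char_pairs : {set charIndex} :=
  [set alpha : charIndex | rook_placement (tag alpha)].

(* u^a_h is the intersection of the ideals J of u^a which are stable under
   GL^a(n) on both sides and satisfy h X h^-1 = X mod J on u^a. *)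
Definition stable_ideal (J : {set A}) : bool :=
  [&& (J \subset ua) && (0 \in J),
      [forall X in J, forall Y in J, X + Y \in J],
      [forall c : F, forall X in J, c *: X \in J],
      [forall X in J, forall Y in ua, (X * Y \in J) && (Y * X \in J)]
    & [forall X in J, forall g : gT, (X * val g \in J) && (val g * X \in J)]].

Definition Ad_trivial h (J : {set A}) : bool :=
  [forall X in ua, val h * X * val h^-1%g - X \in J].

Definition uh h : {set A} :=
  \bigcap_(J : {set A} | stable_ideal J && Ad_trivial h J) J.

(* The projection u^a -> u^a / u^a_h, elements of the quotient being cosets. *)
Definition pi_ h X : {set A} := [set X + Y | Y in uh h].

Definition pi_sat h (S : {set A}) : {set A} :=
  [set X in ua | pi_ h X \in [set pi_ h Y | Y in S]].

Definition classIndex : finType := ({set root} * gT)%type.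

Definition K_ (beta : classIndex) : {set gT} :=
  ((beta.2 ^: Lset) * [set u : gT | val u - 1 \in pi_sat beta.2 (omega beta.1)])%g.

Definition class_equiv : rel classIndex := fun beta beta' =>
  Wequiv beta.1 beta'.1 && (beta'.2 \in beta.2 ^: Lset)%g.

Definition class_pairs : {set classIndex} :=
  [set beta : classIndex | rook_placement beta.1 && (beta.2 \in HD beta.1)].

(* Both relations are equivalences, so transversals of them exist. *)

Lemma Wequiv_refl D : Wequiv D D.
Proof.
have W1 : (1%g : 'S_n.+1) \in WL by rewrite inE; apply/forallP=> i; rewrite perm1.
apply/exists_inP; exists 1%g => //; apply/exists_inP; exists 1%g => //.
apply/eqP; rewrite -[LHS]imset_id; apply: eq_imset => -[i j].
by rewrite invg1 !perm1.
Qed.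

Lemma Wequiv_sym D D' : Wequiv D D' -> Wequiv D' D.
Proof.
have WV w : w \in WL -> (w^-1)%g \in WL.
  rewrite !inE => /forallP Ww; apply/forallP=> i.
  by rewrite -(eqP (Ww _)) permKV.
case/exists_inP=> w1 W1 /exists_inP[w2 W2 /eqP->].
apply/exists_inP; exists (w1^-1)%g; rewrite ?WV //.
apply/exists_inP; exists (w2^-1)%g; rewrite ?WV //.
apply/eqP; rewrite /Wact -imset_comp -[LHS]imset_id; apply: eq_imset => -[i j].
by rewrite /= permK invgK permKV.
Qed.

Lemma Wequiv_trans D D' D'' : Wequiv D D' -> Wequiv D' D'' -> Wequiv D D''.
Proof.
have WM w w' : w \in WL -> w' \in WL -> (w * w')%g \in WL.
  rewrite !inE => /forallP Ww /forallP Ww'; apply/forallP=> i.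
  by rewrite permM (eqP (Ww' _)).
case/exists_inP=> w1 W1 /exists_inP[w2 W2 /eqP->].
case/exists_inP=> v1 V1 /exists_inP[v2 V2 /eqP->].
apply/exists_inP; exists (w1 * v1)%g; rewrite ?WM //.
apply/exists_inP; exists (v2 * w2)%g; rewrite ?WM //.
apply/eqP; rewrite /Wact -imset_comp; apply: eq_imset => -[i j].
by rewrite /= invMg !permM.
Qed.

Lemma char_equivP : equivalence_rel char_equiv.
Proof.
apply/equivalence_relP; split=> [a|a a' /andP[W /forallP e] c].
  by rewrite /char_equiv Wequiv_refl; apply/forallP.
congr andb.
  by apply/idP/idP; apply: Wequiv_trans => //; apply: Wequiv_sym.
by apply: eq_forallb => g; rewrite (eqP (e g)).
Qed.

Lemma class_equivP : equivalence_rel class_equiv.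
Proof.
apply/equivalence_relP; split=> [a|a a' /andP[W /class_eqP e] c].
  by rewrite /class_equiv Wequiv_refl class_refl.
congr andb; last by rewrite e.
by apply/idP/idP; apply: Wequiv_trans => //; apply: Wequiv_sym.
Qed.

End Contraction.

Arguments charIndex F {n l} b.
Arguments classIndex F {n l} b.
Arguments char_pairs F {n l} b.
Arguments class_pairs F {n l} b.
Arguments char_equiv F {n l} b.
Arguments class_equiv F {n l} b.

(* Main.v *)
(* Write G = GL^a(n) and g = h (1 + X) with h in L and X in u^a. Cutting the cyclic
   sequence of blocks 0, ..., l-1 into arcs, gl^a is the quotient of a hereditary
   order by its uniformizer: blocks (k, s) and (s, m) multiply to block (k, m) when s
   lies on the arc from k to m, and to zero otherwise.

   Orbits: Gaussian elimination, with pivots of minimal arc length, brings every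
   X in u^a to some X_D under G x G, and the ranks on the block upper triangular
   quotients attached to arcs recover the number of roots of D in every block, hence
   D up to W_L x W_L. This still works modulo u^a_h, which is spanned by the matrix
   units at the roots gam with h outside H_gam (multiplication by -1 on single
   coordinates, nontrivial since the characteristic is not 2, isolates the
   coordinates of an element of a stable ideal). So the K_beta partition G. The trace
   form makes u^a self-dual as a bimodule, so the Lambda_D are classified likewise.

   Characters: averaging eps (Lambda_D (X z)) over z in u^a gives the indicator
   function of u^a_D times eps (Lambda_D X), whence
     chi_(D, theta) (h (1 + X)) = const * theta h * sum_(x, y in G) eps (Lambda_D (x X y)).
   This is constant on every K_beta, and orthogonality of characters of H_D and of
   u^a gives the disjointness. The numbers of chi's and K's agree because L-conjugacy
   on H_D is H_D-conjugacy. *)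
Require Import Defs.
From HB Require Import structures.
From mathcomp Require Import all_boot all_order all_algebra all_fingroup.
From mathcomp Require Import all_solvable all_field all_character.
From mathcomp Require Import zify.

Set Implicit Arguments.
Unset Strict Implicit.
Unset Printing Implicit Defensive.

Import GRing.Theory Num.Theory.
Local Open Scope ring_scope.

(** * Cyclic arcs of blocks and their lengths *)

Section Arcs.

Variable l : nat.
Implicit Types k s m t : 'I_l.

(* The number of steps from k to m, counted cyclically modulo l. *)
Definition offset (k m : nat) : nat := if (k <= m)%N then (m - k)%N else (m + l - k)%N.

Lemma offset_lt k m : (offset k m < l)%N.
Proof.
by rewrite /offset; have := ltn_ord m; have := ltn_ord k; case: (leqP k m); lia.
Qed.

Lemma offset_cyc k s m : cyc k s m -> offset k m = (offset k s + offset s m)%N.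
Proof.
have := ltn_ord m; have := ltn_ord k; have := ltn_ord s; rewrite /cyc /offset.
by case: (leqP k m); case: (leqP k s); case: (leqP s m) => //=; lia.
Qed.

Lemma cyc_offset_l k s m : cyc k s m = (offset k s <= offset k m)%N.
Proof.
have := ltn_ord m; have := ltn_ord k; have := ltn_ord s; rewrite /cyc /offset.
by case: (leqP k m); case: (leqP k s); case: (leqP s m) => //=; lia.
Qed.

Lemma cyc_offset_r k s m : cyc k s m = (offset s m <= offset k m)%N.
Proof.
have := ltn_ord m; have := ltn_ord k; have := ltn_ord s; rewrite /cyc /offset.
by case: (leqP k m); case: (leqP k s); case: (leqP s m) => //=; lia.
Qed.

Lemma offset_gt0 k m : (0 < offset k m)%N = (k != m).
Proof.
have := ltn_ord m; have := ltn_ord k; rewrite /offset -val_eqE /=.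
by case: (leqP k m) => //=; lia.
Qed.

(** Both sides say that [k], [s], [m] occur in this cyclic order. This rotation makes the trace form
    on u^a compatible with products. *)
Lemma cyc_rot k s m : k != m -> s != m -> cyc k s m = cyc m k s.
Proof.
have := ltn_ord m; have := ltn_ord k; have := ltn_ord s; rewrite /cyc -!val_eqE /=.
by case: (leqP k m); case: (leqP m s) => //=; lia.
Qed.

(* A point t from which the arc from k to m does not wrap around. *)
Lemma cyc_from t k s m : (offset t k <= offset t m)%N ->
  cyc k s m = (offset t k <= offset t s <= offset t m)%N.
Proof.
have := ltn_ord m; have := ltn_ord k; have := ltn_ord s; have := ltn_ord t.
rewrite /cyc /offset.
by case: (leqP k m); case: (leqP t k); case: (leqP t s); case: (leqP t m) => //=; lia.
Qed.

Lemma offset_inj k : injective (fun t : 'I_l => offset k t).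
Proof.
move=> s t; rewrite /offset; have := ltn_ord k; have := ltn_ord s; have := ltn_ord t.
by case: (leqP k s); case: (leqP k t) => c1 c2 lt ls lk e; apply: val_inj => /=; lia.
Qed.

Lemma offset_sub k t s : (offset k t <= offset k s)%N ->
  offset t s = (offset k s - offset k t)%N.
Proof.
by rewrite -cyc_offset_l => /offset_cyc->; rewrite addKn.
Qed.

End Arcs.

(** * Calculus in gl^a and the factorization of G as L times U^a *)

Section Ring.

Variables (F : finFieldType) (n l : nat) (b : 'I_n.+1 -> 'I_l).
Local Notation A := (gla F b).
Local Notation gT := {unit gla F b}.
Local Notation root := ('I_n.+1 * 'I_n.+1)%type.
Implicit Types (X Y Z : A) (g h : gT) (D : {set root}) (gam : root).
Local Notation Lset := (@Lset F n l b).
Local Notation ua := (@ua F n l b).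
Local Notation root_vec := (@root_vec F n l b).

Lemma glaP X Y : (forall i j, X i j = Y i j) -> X = Y.
Proof. by move=> eXY; apply/val_inj/matrixP. Qed.

Lemma glaBE X Y i j : (X - Y) i j = X i j - Y i j.
Proof. by rewrite glaDE glaNE. Qed.

Lemma glaZE (c : F) X i j : (c *: X) i j = c * X i j.
Proof. by rewrite mxE. Qed.

Lemma gla_sumE (I : Type) (r : seq I) (P : pred I) (f : I -> A) i j :
  (\sum_(k <- r | P k) f k) i j = \sum_(k <- r | P k) f k i j.
Proof.
elim: r => [|k r IHr]; first by rewrite !big_nil gla0E.
by rewrite !big_cons; case: (P k); rewrite ?glaDE IHr.
Qed.

Lemma root_vecE gam i j : root_vec gam i j = ((i == gam.1) && (j == gam.2))%:R.
Proof. by rewrite mxE. Qed.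

Lemma mul_root_vecl i s Y p q :
  (root_vec (i, s) * Y) p q =
    if (p == i) && cyc (b p) (b s) (b q) then Y s q else 0.
Proof.
rewrite glaME big_mkcond (bigD1 s) // big1 => [|t /negPf ne_t].
  by rewrite root_vecE eqxx andbT /= addr0; case: (p == i); case: (cyc _ _ _);
    rewrite ?mul0r ?mul1r.
by rewrite root_vecE /= ne_t andbF mul0r if_same.
Qed.

Lemma mul_root_vecr X s j p q :
  (X * root_vec (s, j)) p q =
    if (q == j) && cyc (b p) (b s) (b q) then X p s else 0.
Proof.
rewrite glaME big_mkcond (bigD1 s) // big1 => [|t /negPf ne_t].
  by rewrite root_vecE eqxx /= addr0; case: (q == j); case: (cyc _ _ _);
    rewrite ?mulr0 ?mulr1.
by rewrite root_vecE /= ne_t mulr0 if_same.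
Qed.

Lemma gla_sum_root_vec X : X = \sum_gam X gam.1 gam.2 *: root_vec gam.
Proof.
apply: glaP => i j; rewrite gla_sumE (bigD1 (i, j)) // big1 => [|[p q] ne].
  by rewrite glaZE root_vecE !eqxx /= mulr1 addr0.
by rewrite glaZE root_vecE /= -xpair_eqE eq_sym (negPf ne) mulr0.
Qed.

Definition block_diag X : A := Gla b (\matrix_(i, j) (if b i == b j then X i j else 0)).

Lemma block_diagE X i j : block_diag X i j = if b i == b j then X i j else 0.
Proof. by rewrite mxE. Qed.

(** An arc from a block to itself contains no other block, so the diagonal blocks of a product
    involve diagonal blocks only. This is the projection of gl^a modulo u^a. *)
Lemma block_diagM : {morph block_diag : X Y / X * Y}.
Proof.
move=> X Y; apply: glaP => i j; rewrite block_diagE !glaME.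
case: eqP => [e_ij | /eqP ne_ij].
  apply: eq_bigr => s; rewrite e_ij => /cyc_id/val_inj e_s.
  by rewrite !block_diagE e_s e_ij eqxx.
rewrite big1 // => s _; rewrite !block_diagE.
case: (b i =P b s) => [e|_]; case: (b s =P b j) => [e'|_]; rewrite ?mul0r ?mulr0 //.
by rewrite e e' eqxx in ne_ij.
Qed.

Lemma block_diag1 : block_diag 1 = 1.
Proof.
by apply: glaP => i j; rewrite block_diagE gla1E; case: (i =P j) => [->|]; rewrite ?eqxx ?if_same.
Qed.

Lemma block_diagB X : X - block_diag X \in ua.
Proof. by apply/uaP=> i j /eqP e_ij; rewrite glaBE block_diagE e_ij subrr. Qed.

Lemma ua_mull X Y : Y \in ua -> X * Y \in ua.
Proof.
move/uaP=> Yu; apply/uaP=> i j e_ij; rewrite glaME big1 // => s.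
by rewrite e_ij => /cyc_id/val_inj e_s; rewrite Yu ?mulr0.
Qed.

Lemma ua0 : 0 \in ua.
Proof. by apply/uaP=> *; rewrite gla0E. Qed.
Lemma uaD X Y : X \in ua -> Y \in ua -> X + Y \in ua.
Proof. by move=> /uaP Xu /uaP Yu; apply/uaP=> i j e; rewrite glaDE Xu ?Yu ?addr0. Qed.
Lemma uaN X : X \in ua -> - X \in ua.
Proof. by move=> /uaP Xu; apply/uaP=> i j e; rewrite glaNE Xu ?oppr0. Qed.

(** Every factor from u^a advances by at least one step along the cycle, and the steps add up by
    [offset_cyc]. Since arcs are shorter than [l], the [l]-th power vanishes, and [ua_unit] can
    invert 1 + X by a finite geometric series. *)
Lemma ua_exp X r i j : X \in ua -> (offset l (b i) (b j) < r)%N -> (X ^+ r) i j = 0.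
Proof.
move/uaP=> Xu; elim: r i j => // r IHr i j lt_r; rewrite exprS glaME.
apply: big1 => s /offset_cyc e_off; have [e_is | ne_is] := eqVneq (b i) (b s).
  by rewrite Xu ?mul0r.
by rewrite IHr ?mulr0 //; move: ne_is; rewrite -offset_gt0; lia.
Qed.

Lemma ua_unit X : X \in ua -> 1 + X \is a GRing.unit.
Proof.
move=> Xu; have Xl : (- X) ^+ l = 0.
  by apply: glaP => i j; rewrite gla0E ua_exp ?uaN ?offset_lt.
have := subrX1 (- X) l; rewrite Xl sub0r.
set S := \sum_(_ < _) _ => /(congr1 -%R); rewrite opprK -mulNr opprB opprK => e.
have cXS : (1 + X) * S = S * (1 + X).
  rewrite /S mulr_suml mulr_sumr; apply: eq_bigr => i _.
  by apply/commrX/commrN/commr_sym/commrD; [exact: commr1 | exact: commr_refl].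
by apply/unitrP; exists S; rewrite -cXS -e.
Qed.

(* An opaque copy of [val : gT -> A], whose canonical structures make unification
   prohibitively slow. *)
Fact uval_exists : {f : gT -> A | forall g, f g = val g}.
Proof. by exists val. Qed.
Definition uval : gT -> A := sval uval_exists.
Lemma uvalE g : val g = uval g.
Proof. by rewrite /uval; case: uval_exists => f /= ->. Qed.

Lemma uval_inj : injective uval.
Proof. by move=> g h; rewrite -!uvalE; apply: val_inj. Qed.
Lemma uval1 : uval 1%g = 1.
Proof. by rewrite -uvalE. Qed.
Lemma uvalM g h : uval (g * h)%g = uval g * uval h.
Proof. by rewrite -!uvalE. Qed.
Lemma uvalVK g X : uval g^-1%g * (uval g * X) = X.
Proof. by rewrite mulrA -uvalM mulVg uval1 mul1r. Qed.

(** Turns units of the algebra into group elements, sealed like [uval]; nothing is claimed about the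
    default value taken off the units. *)
Fact gla_unit_exists : {f : A -> gT | forall X, X \is a GRing.unit -> uval (f X) = X}.
Proof. by exists (insubd (1%g : gT)) => X UX; rewrite -uvalE insubdK. Qed.
Definition gla_unit : A -> gT := sval gla_unit_exists.
Lemma uval_gla_unit X : X \is a GRing.unit -> uval (gla_unit X) = X.
Proof. by rewrite /gla_unit; case: gla_unit_exists => f /= H /H. Qed.

Lemma uval_L g i j : g \in Lset -> b i != b j -> uval g i j = 0.
Proof. by rewrite -uvalE => /LsetP; apply. Qed.

Definition Lpart g : gT := gla_unit (block_diag (uval g)).

Lemma uval_Lpart g : uval (Lpart g) = block_diag (uval g).
Proof.
apply: uval_gla_unit; apply/unitrP; exists (block_diag (uval g^-1%g)).
by rewrite -!block_diagM -!uvalM mulgV mulVg uval1 block_diag1.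
Qed.

Lemma Lpart_in g : Lpart g \in Lset.
Proof. by apply/LsetP=> i j ne; rewrite uvalE uval_Lpart block_diagE (negPf ne). Qed.

Lemma Lpart_id h : h \in Lset -> Lpart h = h.
Proof.
move=> Lh; apply: uval_inj; rewrite uval_Lpart.
by apply: glaP => i j; rewrite block_diagE; case: eqP => // /eqP ne; rewrite uval_L.
Qed.

Lemma LpartM g h : Lpart (g * h)%g = (Lpart g * Lpart h)%g.
Proof. by apply: uval_inj; rewrite !(uvalM, uval_Lpart) block_diagM. Qed.

Lemma LpartV g : Lpart g^-1%g = (Lpart g)^-1%g.
Proof.
by apply: (mulgI (Lpart g)); rewrite -LpartM !mulgV Lpart_id ?group1.
Qed.

(** The X in the factorization g = h (1 + X), where h is [Lpart g]. *)
Definition nilpart g : A := uval ((Lpart g)^-1 * g)%g - 1.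

Lemma nilpart_in g : nilpart g \in ua.
Proof.
rewrite /nilpart uvalM -uval1 -(mulVg (Lpart g)) uvalM -mulrBr.
by rewrite uval_Lpart ua_mull ?block_diagB.
Qed.

Definition Upart X : gT := gla_unit (1 + X).

Lemma uval_Upart X : X \in ua -> uval (Upart X) = 1 + X.
Proof. by move=> Xu; rewrite uval_gla_unit ?ua_unit. Qed.

Lemma LU_partE g : g = (Lpart g * Upart (nilpart g))%g.
Proof.
apply: uval_inj; rewrite uvalM uval_Upart ?nilpart_in // /nilpart.
by rewrite addrC subrK -uvalM mulKVg.
Qed.

Lemma Lpart_LU h X : h \in Lset -> X \in ua -> Lpart (h * Upart X)%g = h.
Proof.
move=> Lh Xu; rewrite LpartM Lpart_id // -[RHS]mulg1; congr (_ * _)%g.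
apply: uval_inj; rewrite uval_Lpart uval_Upart // uval1.
apply: glaP => i j; rewrite block_diagE glaDE gla1E.
case: eqP => [e | ne]; first by rewrite (uaP _ Xu) ?addr0.
by case: eqP => // e; case: ne; rewrite e.
Qed.

Lemma nilpart_LU h X : h \in Lset -> X \in ua -> nilpart (h * Upart X)%g = X.
Proof.
by move=> Lh Xu; rewrite /nilpart Lpart_LU // mulKg uval_Upart // addrC addKr.
Qed.

Lemma big_LU (R : nmodType) (f : gT -> R) :
  \sum_g f g = \sum_(h in Lset) \sum_(X in ua) f (h * Upart X)%g.
Proof.
rewrite pair_big_dep /= (reindex_onto (fun u : gT * A => (u.1 * Upart u.2)%g)
  (fun g => (Lpart g, nilpart g))) /=; last by move=> g _; rewrite -LU_partE.
apply: eq_bigl => -[h X] /=; apply/eqP/andP=> [[<- <-]|[Lh Xu]].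
  by rewrite Lpart_in nilpart_in.
by rewrite Lpart_LU ?nilpart_LU.
Qed.

End Ring.

(** * The groups H_gam and an explicit form of the ideal u^a_h *)

Section Stabilizers.

Variables (F : finFieldType) (n l : nat) (b : 'I_n.+1 -> 'I_l).
Local Notation A := (gla F b).
Local Notation gT := {unit gla F b}.
Local Notation root := ('I_n.+1 * 'I_n.+1)%type.
Implicit Types (X Y Z : A) (g h m : gT) (D : {set root}) (gam : root).
Local Notation Lset := (@Lset F n l b).
Local Notation ua := (@ua F n l b).
Local Notation root_vec := (@root_vec F n l b).
Local Notation roots := (@Defs.roots n l b).
Local Notation arc := (@Defs.arc n l b).

(** On roots the two sign cases of [arc] merge into the cyclic arc from the row block to the column
    block, so positive and negative roots can be treated alike. *)
Lemma arcE gam t : gam \in roots -> arc gam t = cyc (b gam.1) t (b gam.2).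
Proof.
rewrite inE -val_eqE /= /arc /cyc => ne.
by case: (ltngtP (b gam.1) (b gam.2)) ne => //= _ _; rewrite orbC.
Qed.

Lemma uHrootP gam h : reflect
  (h \in Lset /\ exists c : F, forall i j, arc gam (b i) -> arc gam (b j) ->
     uval h i j = c *+ (i == j)) (h \in Hroot F b gam).
Proof. by rewrite -uvalE; apply: HrootP. Qed.

Lemma Hroot_L gam h : h \in Hroot F b gam -> h \in Lset.
Proof. by case/uHrootP. Qed.

Lemma Hroot_blocks i j i' j' : b i = b i' -> b j = b j' ->
  Hroot F b (i, j) = Hroot F b (i', j').
Proof. by move=> e e'; rewrite /Hroot /Defs.arc /= e e'. Qed.

Lemma umulL_r X g i j : g \in Lset ->
  (X * uval g) i j = \sum_(s | b s == b j) X i s * uval g s j.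
Proof. by rewrite -uvalE; apply: mulL_r. Qed.
Lemma umulL_l X g i j : g \in Lset ->
  (uval g * X) i j = \sum_(s | b s == b i) uval g i s * X s j.
Proof. by rewrite -uvalE; apply: mulL_l. Qed.

Lemma Hroot_scal gam h : h \in Hroot F b gam -> exists c : F,
  (forall X i j, arc gam (b i) -> (uval h * X) i j = c * X i j) /\
  (forall X i j, arc gam (b j) -> (X * uval h) i j = c * X i j).
Proof.
case/uHrootP=> Lh [c hc]; exists c; split=> X i j ai.
  rewrite umulL_l // (bigD1 i) //= big1 ?addr0 => [|s /andP[/eqP e_s ne_s]].
    by rewrite hc ?eqxx.
  by rewrite hc ?e_s // eq_sym (negPf ne_s) mul0r.
rewrite umulL_r // (bigD1 j) //= big1 ?addr0 => [|s /andP[/eqP e_s ne_s]].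
  by rewrite hc ?eqxx // mulrC.
by rewrite hc ?e_s // (negPf ne_s) mulr0.
Qed.

Lemma Hroot_conj gam h m : m \in Lset -> h \in Hroot F b gam ->
  (h ^ m)%g \in Hroot F b gam.
Proof.
move=> Lm Hh; have [c [hc _]] := Hroot_scal Hh; apply/uHrootP.
split; first by rewrite groupJ ?(Hroot_L Hh).
exists c => i j ai aj; rewrite /conjg uvalM umulL_l ?groupV //.
under eq_bigr => s /eqP e_s do rewrite uvalM hc ?e_s // mulrCA.
rewrite -mulr_sumr -umulL_l ?groupV // -uvalM mulVg uval1 gla1E.
by rewrite mulr_natr.
Qed.

Lemma Hroot_conjE gam h m : m \in Lset ->
  ((h ^ m)%g \in Hroot F b gam) = (h \in Hroot F b gam).
Proof.
move=> Lm; apply/idP/idP; last exact: Hroot_conj.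
by move/(Hroot_conj (groupVr Lm)); rewrite conjgK.
Qed.

Lemma HD_conjE D h m : m \in Lset -> ((h ^ m)%g \in HD F b D) = (h \in HD F b D).
Proof.
move=> Lm; rewrite /HD !in_setI; congr andb; first exact: (memJ_norm _ (subsetP (normG _) _ Lm)).
by apply/bigcapP/bigcapP=> H gam /H; rewrite Hroot_conjE.
Qed.

(** The arc of (s, t) is contained in that of (i, j), and a matrix scalar on an arc is scalar on
    every smaller one. This is what makes [Jh] an ideal. *)
Lemma Hroot_sub i j s t h : cyc (b i) (b s) (b t) -> cyc (b i) (b t) (b j) ->
  b i != b j -> b s != b t ->
  h \in Hroot F b (i, j) -> h \in Hroot F b (s, t).
Proof.
move=> c1 c2 nij nst /uHrootP[Lh [c hc]]; apply/uHrootP; split=> //; exists c => x y.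
have sub z : arc (s, t) z -> arc (i, j) z.
  rewrite !arcE ?inE //= => cz.
  have : cyc (b i) z (b t).
    by move: c1 cz; rewrite !cyc_offset_r; move=> u v; apply: leq_trans v u.
  by move: c2; rewrite !cyc_offset_l; move=> u v; apply: leq_trans v u.
by move=> /sub ax /sub ay; apply: hc.
Qed.

(* An explicit description of u^a_h: see [uhE]. *)
Definition Jh h : {set A} := [set Z in ua | [forall gam in roots,
  (h \in Hroot F b gam) ==> (Z gam.1 gam.2 == 0)]].

Lemma JhP h Z : reflect (Z \in ua /\ forall i j, b i != b j ->
  h \in Hroot F b (i, j) -> Z i j = 0) (Z \in Jh h).
Proof.
apply: (iffP setIdP) => -[Zu ZJ]; split=> //.
  by move=> i j ne Hh; move/forall_inP/(_ (i, j)): ZJ; rewrite inE ne Hh => /(_ isT)/eqP.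
by apply/forall_inP=> -[i j]; rewrite inE => ne; apply/implyP=> Hh; rewrite ZJ.
Qed.

Lemma Jh_conj h m : m \in Lset -> Jh (h ^ m)%g = Jh h.
Proof.
move=> Lm; apply/setP=> Z.
apply/JhP/JhP=> -[Zu ZJ]; split=> // i j ne Hh; apply: ZJ => //.
  by rewrite Hroot_conjE.
by rewrite Hroot_conjE in Hh.
Qed.

Lemma Jh_ua h Z : Z \in Jh h -> Z \in ua. Proof. by case/JhP. Qed.
Lemma Jh0 h : 0 \in Jh h.
Proof. by apply/JhP; split=> [|*]; rewrite ?ua0 ?gla0E. Qed.
Lemma JhD h X Y : X \in Jh h -> Y \in Jh h -> X + Y \in Jh h.
Proof.
case/JhP=> Xu XJ /JhP[Yu YJ]; apply/JhP; split=> [|i j ne Hh]; first exact: uaD.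
by rewrite glaDE XJ ?YJ ?addr0.
Qed.
Lemma JhZ h c X : X \in Jh h -> c *: X \in Jh h.
Proof.
case/JhP=> /uaP Xu XJ; apply/JhP; split=> [|i j ne Hh]; last by rewrite glaZE XJ ?mulr0.
by apply/uaP=> i j e; rewrite glaZE Xu ?mulr0.
Qed.
Lemma JhN h X : X \in Jh h -> - X \in Jh h.
Proof. by rewrite -scaleN1r; apply: JhZ. Qed.
Lemma Jh_mull h X Z : Z \in Jh h -> X * Z \in Jh h.
Proof.
case/JhP=> Zu ZJ; apply/JhP; split=> [|i j ne Hh]; first exact: ua_mull.
rewrite glaME big1 // => s cs; have [e | ne'] := eqVneq (b s) (b j).
  by rewrite (uaP _ Zu) ?mulr0.
have Hsj : h \in Hroot F b (s, j) by apply: Hroot_sub Hh => //; rewrite cyc_r.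
by rewrite ZJ ?mulr0.
Qed.
Lemma Jh_mulr h X Z : Z \in Jh h -> Z * X \in Jh h.
Proof.
case/JhP=> Zu ZJ; apply/JhP; split=> [|i j ne Hh]; first exact: ua_mulr.
rewrite glaME big1 // => s cs; have [e | ne'] := eqVneq (b i) (b s).
  by rewrite (uaP _ Zu) ?mul0r.
have His : h \in Hroot F b (i, s) by apply: Hroot_sub Hh => //; rewrite cyc_l.
by rewrite ZJ ?mul0r.
Qed.

(** At a root (i, j) with h in H_(i, j), left and right multiplication by h scale the entry by the
    same constant, as both end blocks lie on the arc. *)
Lemma Jh_comm h X : h \in Lset -> X \in ua -> uval h * X - X * uval h \in Jh h.
Proof.
move=> Lh Xu; apply/JhP; split=> [|i j ne Hh].
  by apply: uaD; [apply: ua_mull | apply/uaN/ua_mulr].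
have [c [hl hr]] := Hroot_scal Hh.
have r : (i, j) \in roots by rewrite inE.
by rewrite glaBE hl ?hr ?arcE ?cyc_l ?cyc_r ?subrr.
Qed.

Lemma stable_Jh h : stable_ideal (Jh h).
Proof.
apply/and5P; split.
- by rewrite Jh0 andbT; apply/subsetP=> X /Jh_ua.
- by apply/forall_inP=> X JX; apply/forall_inP=> Y JY; apply: JhD.
- by apply/forallP=> c; apply/forall_inP=> X; apply: JhZ.
- by apply/forall_inP=> X JX; apply/forall_inP=> Y _;
  rewrite [X * Y \in _]Jh_mulr ?[Y * X \in _]Jh_mull.
by apply/forall_inP=> X JX; apply/forallP=> g;
  rewrite [X * _ \in _]Jh_mulr ?[_ * X \in _]Jh_mull.
Qed.

Lemma Ad_trivial_Jh h : h \in Lset -> Ad_trivial h (Jh h).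
Proof.
move=> Lh; apply/forall_inP=> X Xu; rewrite !uvalE.
have -> : uval h * X * uval h^-1%g - X = (uval h * X - X * uval h) * uval h^-1%g.
  by rewrite mulrBl -[X * _ * _]mulrA -uvalM mulgV uval1 mulr1.
exact/Jh_mulr/Jh_comm.
Qed.

Lemma root_vec_sandwich X p q : root_vec (p, p) * X * root_vec (q, q) = X p q *: root_vec (p, q).
Proof.
apply: glaP => x y; rewrite glaZE root_vecE mul_root_vecr mul_root_vecl /=.
case: (x =P p) => [->|_]; case: (y =P q) => [->|_]; rewrite ?mulr0 ?mulr1 ?if_same //=.
by rewrite cyc_l cyc_r.
Qed.

Hypothesis charF : 2%N \notin [pchar F].

Lemma natr2_neq0 : 2%:R != 0 :> F.
Proof. by apply: contra charF => e; rewrite inE /=. Qed.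

(* 1 + c E is a unit: E squares to zero when i != s, and 1 - 2 E is an involution
   when i = s. *)
Lemma root_vec_unit i s : b i = b s ->
  exists (c : F) g, c != 0 /\ uval g = 1 + c *: root_vec (i, s).
Proof.
move=> e; have sq : root_vec (i, s) * root_vec (i, s) = root_vec (i, s) *+ (i == s).
  apply: glaP => x y; rewrite mul_root_vecl root_vecE /=.
  case: (eqVneq i s) => [<-|ne]; last first.
    by rewrite /= mulr0n (@gla0E F n l b) if_same.
  by rewrite mulr1n root_vecE /=; case: eqP => //= ->; rewrite cyc_l.
pose c : F := if i == s then - 2%:R else 1.
have cn : c != 0 by rewrite /c; case: ifP; rewrite ?oppr_eq0 ?natr2_neq0 ?oner_eq0.
pose d : F := if i == s then - 2%:R else - 1.
have cd : c + d + c * d *+ (i == s) = 0.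
  rewrite /c /d; case: eqP => _; last by rewrite subrr mulr0n addr0.
  by rewrite mulrN mulNr opprK mulr1n -natrM -opprD -natrD addNr.
have prod (u v : F) : (1 + u *: root_vec (i, s)) * (1 + v *: root_vec (i, s)) =
    1 + (u + v + u * v *+ (i == s)) *: root_vec (i, s).
  rewrite mulrDl mul1r mulrDr mulr1 -scalerAl -scalerAr sq scalerA -scalerMnr.
  by rewrite scalerMnl !scalerDl -!addrA; congr (_ + _); rewrite addrCA.
have UX : 1 + c *: root_vec (i, s) \is a GRing.unit.
  apply/unitrP; exists (1 + d *: root_vec (i, s)).
  by rewrite !prod [d + c]addrC [d * c]mulrC cd scale0r addr0.
by exists c, (gla_unit (1 + c *: root_vec (i, s))); rewrite uval_gla_unit.
Qed.

Section Ideal.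

Variable J : {set A}.
Hypothesis stJ : stable_ideal J.

Lemma stable_idealD X Y : X \in J -> Y \in J -> X + Y \in J.
Proof. by case/and5P: stJ => _ /forall_inP H _ _ _ /H/forall_inP; apply. Qed.
Lemma stable_idealZ c X : X \in J -> c *: X \in J.
Proof. by case/and5P: stJ => _ _ /forallP/(_ c)/forall_inP H _ _; apply: H. Qed.
Lemma stable_ideal0 : 0 \in J.
Proof. by case/and5P: stJ => /andP[]. Qed.
Lemma stable_ideal_sum (I : finType) (P : pred I) (f : I -> A) :
  (forall i, P i -> f i \in J) -> \sum_(i | P i) f i \in J.
Proof.
move=> fJ; elim/big_rec: _ => [|i X Pi XJ]; first exact: stable_ideal0.
by apply: stable_idealD => //; apply: fJ.
Qed.

(** Matrix units at roots lie in u^a, while those inside a diagonal block have the form c^-1 (g - 1)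
    with g in the group. Hence a stable ideal is a two-sided ideal of all of gl^a. *)
Lemma stable_ideal_root_vec gam Z : Z \in J ->
  root_vec gam * Z \in J /\ Z * root_vec gam \in J.
Proof.
case/and5P: stJ => _ _ _ /forall_inP Ju /forall_inP Jg; case: gam => i s JZ.
have [e | ne] := eqVneq (b i) (b s); last first.
  have Eu : root_vec (i, s) \in ua.
    apply/uaP=> x y exy; rewrite root_vecE /=; case: (x =P i) => //= ex.
    by case: (y =P s) => //= ey; case/eqP: ne; rewrite -ex -ey.
  by have /forall_inP/(_ _ Eu)/andP[] := Ju _ JZ.
have [c [g [cn gE]]] := root_vec_unit e.
have /forallP/(_ g) := Jg _ JZ; rewrite !uvalE => /andP[Zg gZ].
have -> : root_vec (i, s) = c^-1 *: (uval g - 1) by rewrite gE addrC addKr scalerK.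
rewrite -scalerAl -scalerAr mulrBl mulrBr mul1r mulr1 -scaleN1r.
by split; apply/stable_idealZ/stable_idealD => //; apply: stable_idealZ.
Qed.

Lemma stable_ideal_mull X Z : Z \in J -> X * Z \in J.
Proof.
move=> JZ; rewrite [X]gla_sum_root_vec mulr_suml; apply: stable_ideal_sum => gam _.
by rewrite -scalerAl; apply: stable_idealZ; case: (stable_ideal_root_vec gam JZ).
Qed.
Lemma stable_ideal_mulr X Z : Z \in J -> Z * X \in J.
Proof.
move=> JZ; rewrite [X]gla_sum_root_vec mulr_sumr; apply: stable_ideal_sum => gam _.
by rewrite -scalerAr; apply: stable_idealZ; case: (stable_ideal_root_vec gam JZ).
Qed.

(** Multiplication by diagonal matrix units on both sides isolates one coordinate, so a stable ideal
    is spanned by matrix units. *)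
Lemma stable_ideal_entry Z p q : Z \in J -> Z p q != 0 -> root_vec (p, q) \in J.
Proof.
move=> JZ ne; rewrite -[root_vec _](scalerK ne) -root_vec_sandwich.
by apply/stable_idealZ/stable_ideal_mulr/stable_ideal_mull.
Qed.

(** By contraposition: if the unit at (i, j) is not in J, then h must commute with enough matrix
    units to be scalar on the whole arc of (i, j). *)
Lemma root_vec_stable_ideal h i j : h \in Lset -> Ad_trivial h J -> b i != b j ->
  h \notin Hroot F b (i, j) -> root_vec (i, j) \in J.
Proof.
move=> Lh /forall_inP AdJ nij; apply: contraR => nJ.
(* No matrix unit on a smaller arc lies in J either, since the one at (i, j) is a multiple of it. *)
have nJsub s t : cyc (b i) (b s) (b t) -> cyc (b i) (b t) (b j) -> root_vec (s, t) \notin J.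
  move=> c1 c2; apply: contra nJ => Jst.
  suff -> : root_vec (i, j) = root_vec (i, s) * root_vec (s, t) * root_vec (t, j).
    by apply/stable_ideal_mulr/stable_ideal_mull.
  apply: glaP => x y; rewrite root_vecE mul_root_vecr mul_root_vecl root_vecE !eqxx /=.
  case: (x =P i) => [->|_]; case: (y =P j) => [->|_]; rewrite ?if_same //=.
  by rewrite c1 c2.
have Jcomm s t p q : b s != b t -> root_vec (p, q) \notin J ->
    (uval h * root_vec (s, t)) p q = (root_vec (s, t) * uval h) p q.
  move=> nst; apply: contraNeq; rewrite -subr_eq0 -glaBE; apply: stable_ideal_entry.
  have Eu : root_vec (s, t) \in ua.
    apply/uaP=> x y exy; rewrite root_vecE /=; case: (x =P s) => //= ex.
    by case: (y =P t) => //= ey; case/eqP: nst; rewrite -ex -ey.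
  have := stable_ideal_mulr (uval h) (AdJ _ Eu).
  by rewrite !uvalE mulrBl -[_ * uval h^-1%g * _]mulrA -uvalM mulVg uval1 mulr1.
have r : (i, j) \in roots by rewrite inE.
(* On blocks other than the last one, commutation with the unit at (y, j), read at (x, j), compares
   the entry of h at (x, y) with the one at (j, j). *)
have Hj x y : b x = b y -> b x != b j -> cyc (b i) (b x) (b j) ->
    uval h x y = uval h j j *+ (x == y).
  move=> exy nxj cx; have := Jcomm y j x j; rewrite -exy nxj nJsub ?cyc_r //.
  move/(_ isT isT); rewrite mul_root_vecr mul_root_vecl -exy eqxx cyc_l cyc_r /=.
  by rewrite andbT mulrb.
apply/uHrootP; split=> //; exists (uval h j j) => x y; rewrite !arcE //= => cx cy.
have [exy | nxy] := eqVneq (b x) (b y); last first.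
  by rewrite uval_L //; case: (x =P y) nxy => [->|]; rewrite ?eqxx.
have [exj | nxj] := eqVneq (b x) (b j); last exact: Hj.
(* The last block is handled through row i: commutation with the unit at (i, x), read at (i, y),
   compares it with the entry of h at (i, i). *)
have eii : uval h i i = uval h j j by rewrite (Hj i i) ?cyc_l // eqxx.
have nix : b i != b x by rewrite exj.
have niy : root_vec (i, y) \notin J by apply: nJsub; rewrite ?cyc_l // -exy exj cyc_r.
have := Jcomm i x i y nix niy.
rewrite mul_root_vecr mul_root_vecl -exy eqxx cyc_l cyc_r /= andbT eii.
by rewrite mulrb [y == x]eq_sym => ->.
Qed.

Lemma Jh_sub_stable_ideal h : h \in Lset -> Ad_trivial h J -> Jh h \subset J.
Proof.
move=> Lh AdJ; apply/subsetP=> Z /JhP[/uaP Zu ZJ].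
rewrite [Z]gla_sum_root_vec; apply: stable_ideal_sum => -[i j] _ /=.
have [e|ne] := eqVneq (b i) (b j); first by rewrite Zu // scale0r stable_ideal0.
have [Hh|Hh] := boolP (h \in Hroot F b (i, j)).
  by rewrite ZJ // scale0r stable_ideal0.
exact/stable_idealZ/(root_vec_stable_ideal Lh).
Qed.

End Ideal.

Lemma uhE h : h \in Lset -> uh h = Jh h.
Proof.
move=> Lh; apply/eqP; rewrite eqEsubset; apply/andP; split.
  by apply: bigcap_inf; rewrite stable_Jh Ad_trivial_Jh.
by apply/bigcapsP=> J /andP[stJ AdJ]; apply: Jh_sub_stable_ideal.
Qed.

End Stabilizers.

(** * Gaussian elimination to rook placements *)

Section RookReduction.

Variables (F : finFieldType) (n l : nat) (b : 'I_n.+1 -> 'I_l).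
Local Notation A := (gla F b).
Local Notation gT := {unit gla F b}.
Local Notation root := ('I_n.+1 * 'I_n.+1)%type.
Implicit Types (X Y Z : A) (g h x y : gT) (D : {set root}) (gam : root).
Local Notation ua := (@ua F n l b).
Local Notation roots := (@Defs.roots n l b).
Local Notation X_ := (@X_ F n l b).

Lemma rookP D : reflect
  [/\ forall gam, gam \in D -> b gam.1 != b gam.2,
      {in D &, forall gam gam', gam.1 = gam'.1 -> gam = gam'}
    & {in D &, forall gam gam', gam.2 = gam'.2 -> gam = gam'}] (rook_placement b D).
Proof.
apply: (iffP and3P) => [[/subsetP s /dinjectiveP i1 /dinjectiveP i2]|[s i1 i2]].
  by split=> // gam /s; rewrite inE.
by split; [apply/subsetP=> gam /s; rewrite inE | apply/dinjectiveP | apply/dinjectiveP].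
Qed.

Lemma X_E D i j : X_ D i j = ((i, j) \in D)%:R.
Proof.
rewrite gla_sumE; have [Dij | nDij] := boolP ((i, j) \in D).
  rewrite (bigD1 (i, j)) // big1 => [|[p q] /andP[_ ne]].
    by rewrite root_vecE /= !eqxx addr0.
  by rewrite root_vecE /= -xpair_eqE eq_sym (negPf ne).
rewrite big1 // => -[p q] Dpq; rewrite root_vecE /= -xpair_eqE.
by case: eqP Dpq nDij => // -> ->.
Qed.

Lemma X_ua D : rook_placement b D -> X_ D \in ua.
Proof.
case/rookP=> Dr _ _; apply/uaP=> i j e; rewrite X_E.
by case: ((i, j) \in D) (Dr (i, j)) => //= /(_ isT); rewrite e eqxx.
Qed.

(** The inverse is 1 - (1 + a)^-1 Y, as in the formula for rank one perturbations. *)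
Lemma quasi_idem_unit Y (a : F) : Y * Y = a *: Y -> 1 + a != 0 ->
  1 + Y \is a GRing.unit.
Proof.
move=> YY a1; pose t := - (1 + a)^-1.
have e : 1 + t + t * a = 0 by rewrite -addrA -[X in X + t * a]mulr1 -mulrDr mulNr mulVf ?subrr.
have cY : (1 + Y) * (t *: Y) = (t *: Y) * (1 + Y).
  by rewrite mulrDl mulrDr mul1r mulr1 -scalerAl -scalerAr.
have e1 : (1 + Y) * (1 + t *: Y) = 1.
  rewrite mulrDr mulr1 mulrDl mul1r -scalerAr YY scalerA -addrA -{1}[Y]scale1r.
  by rewrite -!scalerDl addrA e scale0r addr0.
apply/unitrP; exists (1 + t *: Y); split=> //; rewrite -[RHS]e1.
by rewrite mulrDl mul1r -cY mulrDr mulr1.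
Qed.

(** Right multiplication by [1 + row_mat j v] adds [v s] times column j to column s, and left
    multiplication by [1 + col_mat i w] adds [w r] times row i to row r, wherever the arcs permit
    it. *)
Definition row_mat j (v : 'I_n.+1 -> F) : A :=
  Gla b (\matrix_(r, s) (if r == j then v s else 0)).
Definition col_mat i (w : 'I_n.+1 -> F) : A :=
  Gla b (\matrix_(r, s) (if s == i then w r else 0)).

Lemma mul_row_mat X j v r s : (X * row_mat j v) r s =
  if cyc (b r) (b j) (b s) then X r j * v s else 0.
Proof.
rewrite glaME big_mkcond (bigD1 j) //= big1 => [|t /negPf ne].
  by rewrite mxE eqxx addr0.
by rewrite mxE ne mulr0 if_same.
Qed.
Lemma mul_col_mat X i w r s : (col_mat i w * X) r s =
  if cyc (b r) (b i) (b s) then w r * X i s else 0.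
Proof.
rewrite glaME big_mkcond (bigD1 i) //= big1 => [|t /negPf ne].
  by rewrite mxE eqxx addr0.
by rewrite mxE ne mul0r if_same.
Qed.

Lemma row_mat_unit j v : 1 + v j != 0 -> 1 + row_mat j v \is a GRing.unit.
Proof.
apply: quasi_idem_unit; apply: glaP => r s; rewrite mul_row_mat glaZE /= !mxE.
by case: (r =P j) => [->|_]; rewrite ?cyc_l // mul0r mulr0 if_same.
Qed.
Lemma col_mat_unit i w : 1 + w i != 0 -> 1 + col_mat i w \is a GRing.unit.
Proof.
apply: quasi_idem_unit; apply: glaP => r s; rewrite mul_col_mat glaZE /= !mxE.
by case: (s =P i) => [->|_]; rewrite ?cyc_r ?mulr0 ?if_same // mulrC.
Qed.

(** The invariant of the elimination: rows and columns met by D have reached their final form. *)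
Definition reduced_at D X := forall i j,
  (i \in [set gam.1 | gam in D]) || (j \in [set gam.2 | gam in D]) ->
  X i j = ((i, j) \in D)%:R.

(* Each pivot is a nonzero entry outside of D with the shortest possible arc: then
   both the column operations clearing its row and the row operations clearing its
   column are available in gl^a. *)
Lemma reduce_pivot D X i j : rook_placement b D -> X \in ua -> reduced_at D X ->
    X i j != 0 -> (i, j) \notin D ->
    (forall r s, X r s != 0 -> (r, s) \notin D ->
      (offset l (b i) (b j) <= offset l (b r) (b s))%N) ->
  exists x y, [/\ rook_placement b ((i, j) |: D), uval x * X * uval y \in ua
    & reduced_at ((i, j) |: D) (uval x * X * uval y)].
Proof.
move=> rD Xu red nz nD minij.
have iD : i \notin [set gam.1 | gam in D].
  by apply: contra nz => iD; rewrite red ?iD // (negPf nD).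
have jD : j \notin [set gam.2 | gam in D].
  by apply: contra nz => jD; rewrite red ?jD ?orbT // (negPf nD).
have niD s : (i, s) \notin D by apply: contra iD => Ds; apply/imsetP; exists (i, s).
have njD r : (r, j) \notin D by apply: contra jD => Dr; apply/imsetP; exists (r, j).
(* The value at j rescales the pivot to 1, since X i j (1 + v j) = 1; the other values clear the
   rest of row i. *)
pose c := X i j; pose v s := if s == j then c^-1 - 1 else - (c^-1 * X i s).
have Uv : 1 + row_mat j v \is a GRing.unit.
  by apply: row_mat_unit; rewrite /v eqxx addrC subrK invr_eq0.
pose X1 := X * (1 + row_mat j v).
have X1E r s : X1 r s = X r s + if cyc (b r) (b j) (b s) then X r j * v s else 0.
  by rewrite /X1 mulrDr mulr1 glaDE mul_row_mat.
have X1i s : X1 i s = (s == j)%:R.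
  rewrite X1E /v; case: (s =P j) => [->|_].
    by rewrite cyc_r mulrBr mulr1 divff // -/c addrC subrK.
  have [-> | nzs] := eqVneq (X i s) 0; first by rewrite mulr0 oppr0 mulr0 if_same addr0.
  by rewrite cyc_offset_l minij // mulrN mulVKf ?subrr.
(* Finished rows vanish at column j, and [v] vanishes on finished columns, so neither changes. *)
have X1D r s : (r \in [set gam.1 | gam in D]) || (s \in [set gam.2 | gam in D]) ->
    X1 r s = ((r, s) \in D)%:R.
  move=> rsD; rewrite X1E red //; case/orP: rsD => [rD' | sD].
    by rewrite [X r j]red ?rD' // (negPf (njD r)) mul0r if_same addr0.
  rewrite /v; case: (s =P j) sD => [->|_ sD]; first by rewrite (negPf jD).
  by rewrite [X i s]red ?sD ?orbT // (negPf (niD s)) mulr0 oppr0 mulr0 if_same addr0.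
have X1j r : X1 r j = X r j * c^-1.
  by rewrite X1E cyc_r /v eqxx mulrBr mulr1 addrC subrK.
(* Row i of X1 is now zero apart from the pivot, so adding multiples of it clears column j and
   touches nothing else. *)
pose w r := if r == i then 0 else - X1 r j.
have Uw : 1 + col_mat i w \is a GRing.unit.
  by apply: col_mat_unit; rewrite /w eqxx addr0 oner_eq0.
exists (gla_unit (1 + col_mat i w)), (gla_unit (1 + row_mat j v)).
rewrite (uval_gla_unit Uw) (uval_gla_unit Uv) -mulrA.
rewrite -/X1.
have X2E r s : ((1 + col_mat i w) * X1) r s =
    X1 r s + (if (s == j) && cyc (b r) (b i) (b j) then w r else 0).
  rewrite mulrDl mul1r glaDE mul_col_mat X1i.
  by case: (s =P j) => [->|_]; rewrite ?mulr1 //= mulr0 if_same.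
split.
- case/rookP: rD => Dr i1 i2; apply/rookP; split.
  + move=> gam /setU1P[-> /=|/Dr//].
    by apply: contra nz => /eqP e; rewrite (uaP _ Xu).
  + move=> gam gam' /setU1P[->|Dg] /setU1P[->|Dg'] //= e; last exact: i1.
      by case/negP: iD; apply/imsetP; exists gam'.
    by case/negP: iD; apply/imsetP; exists gam.
  + move=> gam gam' /setU1P[->|Dg] /setU1P[->|Dg'] //= e; last exact: i2.
      by case/negP: jD; apply/imsetP; exists gam'.
    by case/negP: jD; apply/imsetP; exists gam.
- by apply/ua_mull/ua_mulr.
move=> r s rs; rewrite X2E in_setU1 xpair_eqE.
have [er | nri] := eqVneq r i.
  by rewrite er X1i /w eqxx if_same addr0 (negPf (niD s)) orbF.
have [es | nsj] := eqVneq s j.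
  rewrite es /= (negPf (njD r)) /w (negPf nri).
  have [e0 | nz1] := eqVneq (X1 r j) 0; first by rewrite e0 oppr0 if_same addr0.
  rewrite cyc_offset_r minij ?subrr //.
  by move: nz1; rewrite X1j mulf_eq0 negb_or => /andP[].
rewrite /= addr0 X1D //; move: rs; rewrite imsetU1 imsetU1 !in_setU1.
by rewrite (negPf nri) (negPf nsj).
Qed.

Lemma rook_reduction D X : rook_placement b D -> X \in ua -> reduced_at D X ->
  exists D' x y, rook_placement b D' /\ uval x * X * uval y = X_ D'.
Proof.
have [k] := ubnP #|~: D|; elim: k D X => // k IHk D X leD rD Xu red.
have [nz | allD] := boolP [exists gam, (X gam.1 gam.2 != 0) && (gam \notin D)]; last first.
  exists D, 1%g, 1%g; split=> //; rewrite uval1 mul1r mulr1; apply: glaP => i j.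
  rewrite X_E; have [Dij | nD] := boolP ((i, j) \in D).
    by rewrite red ?Dij //; apply/orP; left; apply/imsetP; exists (i, j).
  by move: allD; rewrite negb_exists => /forallP/(_ (i, j)); rewrite nD andbT negbK => /eqP.
have [gam0 P0] := existsP nz.
pose P gam := (X gam.1 gam.2 != 0) && (gam \notin D).
case: (@arg_minnP _ gam0 P (fun gam => offset l (b gam.1) (b gam.2)) P0) => -[i j] /=.
case/andP=> nzij nD minij.
have [r s nzrs nDrs | x [y [rD' Xu' red']]] := reduce_pivot rD Xu red nzij nD.
  by apply: (minij (r, s)); rewrite /P /= nzrs.
have [|D' [x' [y' [rD'' e]]]] := IHk _ _ _ rD' Xu' red'.
  rewrite -ltnS; apply: leq_trans leD; rewrite ltnS; apply: proper_card.
  rewrite properE !setCS subsetUr /=; apply: contra nD => /subsetP; apply.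
  exact: setU11.
by exists D', (x' * x)%g, (y * y')%g; split=> //; rewrite !uvalM -e !mulrA.
Qed.

Lemma rook_exists X : X \in ua ->
  exists D x y, rook_placement b D /\ X = uval x * X_ D * uval y.
Proof.
move=> Xu; have r0 : rook_placement b set0.
  by apply/rookP; split=> gam; rewrite inE.
have red : reduced_at set0 X by move=> i j; rewrite !imset0 !inE.
have [D [x [y [rD e]]]] := rook_reduction r0 Xu red.
exists D, x^-1%g, y^-1%g; split=> //; rewrite -e -!mulrA.
by rewrite -uvalM mulgV uval1 mulr1 uvalVK.
Qed.

End RookReduction.

(** * Ranks, block counts and the uniqueness of the rook placement in an orbit *)

Lemma rank_partial_perm (F : fieldType) (p q : nat) (E : {set 'I_p * 'I_q}) :
    {in E &, forall e e', e.1 = e'.1 -> e = e'} ->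
    {in E &, forall e e', e.2 = e'.2 -> e = e'} ->
  \rank (\matrix_(i, j) ((i, j) \in E)%:R : 'M[F]_(p, q)) = #|E|.
Proof.
move=> inj1 inj2; pose f (a : 'I_#|E|) := enum_val a.
have fE a : f a \in E by apply: enum_valP.
(* The matrix factors through its set of ones; the factors have orthonormal columns and rows
   respectively, so no rank is lost. *)
pose U : 'M[F]_(p, #|E|) := \matrix_(i, a) (i == (f a).1)%:R.
pose V : 'M[F]_(#|E|, q) := \matrix_(a, j) (j == (f a).2)%:R.
have eUV : \matrix_(i, j) ((i, j) \in E)%:R = U *m V.
  apply/matrixP=> i j; rewrite !mxE; have [Eij | nE] := boolP ((i, j) \in E).
    rewrite (bigD1 (enum_rank_in Eij (i, j))) //= big1 => [|a ne].
      by rewrite !mxE /f enum_rankK_in //= !eqxx mulr1 addr0.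
    rewrite !mxE; case: eqP => [e | _]; last by rewrite mul0r.
    by case/eqP: ne; apply: enum_val_inj; rewrite enum_rankK_in //; apply: inj1.
  apply/esym/big1 => a _; rewrite !mxE; case: eqP => [e1|_]; last by rewrite mul0r.
  case: eqP => [e2|_]; last by rewrite mulr0.
  by case/negP: nE; rewrite e1 e2 -surjective_pairing.
have eU : U^T *m U = 1%:M.
  apply/matrixP=> a a'; rewrite !mxE (bigD1 (f a).1) //= big1 => [|i /negPf ne].
    rewrite !mxE eqxx mul1r addr0; case: (eqVneq a a') => [->|ne]; first by rewrite eqxx.
    by case: eqP => // e; case/eqP: ne; apply: enum_val_inj; apply: inj1.
  by rewrite !mxE ne mul0r.
have eV : V *m V^T = 1%:M.
  apply/matrixP=> a a'; rewrite !mxE (bigD1 (f a).2) //= big1 => [|i /negPf ne].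
    rewrite !mxE eqxx mul1r addr0; case: (eqVneq a a') => [->|ne]; first by rewrite eqxx.
    by case: eqP => // e; case/eqP: ne; apply: enum_val_inj; apply: inj2.
  by rewrite !mxE ne mul0r.
apply/eqP; rewrite eqn_leq eUV (leq_trans (mxrankM_maxl _ _) (rank_leq_col _)) /=.
rewrite -[X in (X <= _)%N](mxrank1 F) -{1}eV -[V *m _]mul1mx -eU -!mulmxA.
by rewrite (leq_trans (mxrankM_maxr _ _)) // mulmxA mxrankM_maxl.
Qed.

Section BlockCounts.

Variables (n l : nat) (b : 'I_n.+1 -> 'I_l).
Local Notation root := ('I_n.+1 * 'I_n.+1)%type.
Implicit Types (D : {set root}) (gam : root) (k m : 'I_l).

(** The complete invariant of a rook placement under W_L x W_L. *)
Definition block_count D k m := #|[set gam in D | (b gam.1 == k) && (b gam.2 == m)]|.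

Lemma block_count_gt0 D k m : (0 < block_count D k m)%N ->
  exists2 gam, gam \in D & b gam.1 = k /\ b gam.2 = m.
Proof.
by rewrite card_gt0 => /set0Pn[gam /setIdP[Dg /andP[/eqP e1 /eqP e2]]]; exists gam.
Qed.

Lemma mem_block_count D gam : gam \in D -> (0 < block_count D (b gam.1) (b gam.2))%N.
Proof. by move=> Dg; apply/card_gt0P; exists gam; rewrite inE Dg !eqxx. Qed.

(* Transpositions adjust, one root at a time, the permutations found by induction. *)
Lemma block_count_Wequiv D D' : rook_placement b D -> rook_placement b D' ->
  (forall k m, block_count D k m = block_count D' k m) -> Wequiv b D D'.
Proof.
move=> rD rD' eDD'.
suff [w1 [w2 [W1 W2 eD]]] : exists w1 w2, [/\ w1 \in WL b, w2 \in WL b &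
    D' = [set (w1 gam.1, w2 gam.2) | gam in D]].
  apply/exists_inP; exists w1 => //; apply/exists_inP; exists (w2^-1)%g.
    rewrite inE; apply/forallP=> i; rewrite inE in W2.
    by rewrite -(eqP (forallP W2 _)) permKV.
  by rewrite eD /Wact invgK.
have [k] := ubnP #|D|; elim: k D D' rD rD' eDD' => // k IHk D D' rD rD' eDD' leD.
have [D0 | [gam Dg]] := set_0Vmem D.
  exists 1%g, 1%g; split; try by rewrite inE; apply/forallP=> i; rewrite perm1.
  rewrite D0 imset0; apply/eqP; apply: contraT => /set0Pn[gam /mem_block_count].
  rewrite -eDD' D0; by case/block_count_gt0=> gam'; rewrite inE.
have [gam' Dg' [e1 e2]] : exists2 gam', gam' \in D' & b gam'.1 = b gam.1 /\ b gam'.2 = b gam.2.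
  by apply: block_count_gt0; rewrite -eDD' mem_block_count.
have sub_rook D0 g : rook_placement b D0 -> rook_placement b (D0 :\ g).
  case/rookP=> Dr i1 i2; apply/rookP; split=> [a /setD1P[_]|a a'|a a'].
  - exact: Dr.
  - by move=> /setD1P[_ Da] /setD1P[_ Da']; apply: i1.
  - by move=> /setD1P[_ Da] /setD1P[_ Da']; apply: i2.
have eCnt D0 g k0 m0 : g \in D0 ->
    block_count D0 k0 m0 = (((b g.1 == k0) && (b g.2 == m0)) + block_count (D0 :\ g) k0 m0)%N.
  move=> D0g; rewrite /block_count (cardsD1 g) inE D0g /=; congr (_ + _)%N.
  by apply: eq_card => a; rewrite !inE andbA.
have [||w1 [w2 [W1 W2 eD]]] := IHk _ _ (sub_rook D gam rD) (sub_rook D' gam' rD').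
- move=> k0 m0; have := eDD' k0 m0; rewrite (eCnt _ _ _ _ Dg) (eCnt _ _ _ _ Dg').
  by rewrite e1 e2 => /addnI.
- by move: leD; rewrite ltnS; apply: leq_trans; rewrite [X in (_ <= X)%N](cardsD1 gam) Dg.
have WLP (w : 'S_n.+1) : reflect (forall i, b (w i) = b i) (w \in WL b).
  by rewrite inE; apply: (iffP forallP) => H i; apply/eqP.
have tpW (w : 'S_n.+1) x y : w \in WL b -> b x = b y -> (w * tperm (w x) y)%g \in WL b.
  move=> /WLP Ww exy; apply/WLP=> i; rewrite permM.
  by case: tpermP => [e|e|_ _]; rewrite -?exy ?Ww // -(Ww i) e ?Ww ?exy.
have [_ j1 j2] := rookP _ _ rD; have [_ j1' j2'] := rookP _ _ rD'.
exists (w1 * tperm (w1 gam.1) gam'.1)%g, (w2 * tperm (w2 gam.2) gam'.2)%g.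
split; rewrite ?tpW //.
have wD' a : a \in D :\ gam -> (w1 a.1, w2 a.2) \in D' :\ gam'.
  by move=> Da; rewrite eD; apply: imset_f.
rewrite -(setD1K Dg') -(setD1K Dg) imsetU1 eD; congr setU.
  by rewrite !permM !tpermL -surjective_pairing.
apply: eq_in_imset => a Da; have /setD1P[nag DaD] := Da.
have /setD1P[ne' Da'] := wD' _ Da.
(* The transpositions fix the images of the remaining roots: by the rook condition on D and D',
   these share no row or column with the image of [gam] or with [gam']. *)
rewrite !permM !tpermD //.
- by apply: contra nag => /eqP/perm_inj e; apply/eqP/j2.
- by apply: contra ne' => /eqP e; apply/eqP/j2'.
- by apply: contra nag => /eqP/perm_inj e; apply/eqP/j1.
- by apply: contra ne' => /eqP e; apply/eqP/j1'.
Qed.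

Lemma Wequiv_block_count D D' k m : Wequiv b D D' ->
  block_count D k m = block_count D' k m.
Proof.
case/exists_inP=> w1 W1 /exists_inP[w2 W2 /eqP->].
rewrite inE in W1; rewrite inE in W2; rewrite /block_count.
have inj : injective (fun gam : root => (w1 gam.1, (w2^-1)%g gam.2)).
  by move=> [i j] [i' j'] [] /perm_inj-> /perm_inj->.
rewrite -(card_imset _ inj); apply: eq_card => gam; apply/imsetP/setIdP.
  case=> a /setIdP[Da /andP[/eqP<- /eqP<-]] ->; split; first exact: imset_f.
  by rewrite (eqP (forallP W1 _)) eqxx -(eqP (forallP W2 _)) permKV /=.
case=> /imsetP[a Da ->] /=; rewrite (eqP (forallP W1 _)).
rewrite -(eqP (forallP W2 ((w2^-1)%g _))) permKV => H; exists a => //.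
by rewrite inE Da.
Qed.

End BlockCounts.

Section RookUniqueness.

Variables (F : finFieldType) (n l : nat) (b : 'I_n.+1 -> 'I_l).
Local Notation A := (gla F b).
Local Notation gT := {unit gla F b}.
Local Notation root := ('I_n.+1 * 'I_n.+1)%type.
Implicit Types (X Y Z : A) (g h x y : gT) (D : {set root}) (gam : root) (k m : 'I_l).
Local Notation ua := (@ua F n l b).
Local Notation X_ := (@X_ F n l b).

(* The arc from k to m cuts out a quotient of gl^a which is an algebra of block
   upper triangular matrices, with the blocks ordered along the arc. *)
Definition arc_quot k m X : 'M[F]_n.+1 := \matrix_(i, j)
  (if (offset l k (b i) <= offset l k (b j) <= offset l k m)%N then X i j else 0).

Lemma arc_quotM k m X Y : arc_quot k m (X * Y) = arc_quot k m X *m arc_quot k m Y.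
Proof.
apply/matrixP=> i j; rewrite [LHS]mxE [RHS]mxE glaME; case: ifP => [/andP[le_ij le_jm] | out].
  rewrite big_mkcond; apply: eq_bigr => s _; rewrite !mxE (cyc_from _ le_ij).
  case: (leqP (offset l k (b i)) _) => [le_is|_]; last by rewrite mul0r.
  case: (leqP (offset l k (b s)) (offset l k (b j))) => [le_sj|_] /=; last by rewrite mulr0.
  by rewrite (leq_trans le_sj le_jm) le_jm.
apply/esym/big1 => s _; rewrite !mxE; case: ifP => [/andP[le_is _]|]; last by rewrite mul0r.
case: ifP => [/andP[le_sj le_jm]|]; last by rewrite mulr0.
by rewrite (leq_trans le_is le_sj) le_jm in out.
Qed.

Lemma rank_arc_quot_orbit k m x X y :
  \rank (arc_quot k m (uval x * X * uval y)) = \rank (arc_quot k m X).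
Proof.
have le x' y' Z : (\rank (arc_quot k m (uval x' * Z * uval y')%R) <= \rank (arc_quot k m Z))%N.
  by rewrite !arc_quotM (leq_trans (mxrankM_maxl _ _)) ?mxrankM_maxr.
apply/eqP; rewrite eqn_leq le.
rewrite -{1}[X](_ : uval x^-1%g * (uval x * X * uval y) * uval y^-1%g = X) ?le //.
by rewrite -!mulrA -uvalM mulgV uval1 mulr1 uvalVK.
Qed.

Definition arc_roots k m D :=
  [set gam in D | (offset l k (b gam.1) <= offset l k (b gam.2) <= offset l k m)%N].

Lemma rank_arc_quot_X_ k m D : rook_placement b D ->
  \rank (arc_quot k m (X_ D)) = #|arc_roots k m D|.
Proof.
case/rookP=> _ i1 i2; rewrite -(@rank_partial_perm F).
- congr mxrank; apply/matrixP=> i j; rewrite !mxE X_E inE /=.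
  by case: ifP; rewrite ?andbT ?andbF.
- by move=> a a' /setIdP[Da _] /setIdP[Da' _]; apply: i1.
- by move=> a a' /setIdP[Da _] /setIdP[Da' _]; apply: i2.
Qed.

Lemma card_arc_roots k m D : #|arc_roots k m D| =
  (\sum_(ts : 'I_l * 'I_l | (offset l k ts.1 <= offset l k ts.2 <= offset l k m)%N)
     block_count b D ts.1 ts.2)%N.
Proof.
rewrite -sum1_card (partition_big (fun gam : root => (b gam.1, b gam.2)) (fun ts : 'I_l * 'I_l =>
  (offset l k ts.1 <= offset l k ts.2 <= offset l k m)%N)) /=; last by move=> gam /setIdP[].
apply: eq_bigr => -[t s] /= cond; rewrite /block_count -sum1_card; apply: eq_bigl => gam.
rewrite !inE xpair_eqE; case: eqP => [->|]; rewrite ?andbF //=.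
by case: eqP => [->|]; rewrite ?andbF //= cond andbT.
Qed.

(** The number of roots on the arc is the sum of the block counts over its subarcs. All of these but
    the arc from k to m itself are strictly shorter, so the last term is determined by the
    others. *)
Lemma arc_roots_block_count D D' k m :
    (forall t s : 'I_l, (offset l t s < offset l k m)%N ->
       block_count b D t s = block_count b D' t s) ->
    #|arc_roots k m D| = #|arc_roots k m D'| ->
  block_count b D k m = block_count b D' k m.
Proof.
move=> IH; rewrite !card_arc_roots.
have Pkm : (fun ts : 'I_l * 'I_l => (offset l k ts.1 <= offset l k ts.2 <= offset l k m)%N) (k, m).
  by rewrite /= leqnn andbT; case: (posnP (offset l k k)) => [->//|]; rewrite offset_gt0 eqxx.
rewrite [X in X = _ -> _](bigD1 (k, m)) ?[X in _ = X -> _](bigD1 (k, m)) /=; try exact: Pkm.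
rewrite [X in (_ + X)%N = _ -> _](eq_bigr (fun ts => block_count b D' ts.1 ts.2)).
  by move/addIn.
case=> t s /= /andP[/andP[le_ts le_sm] ne]; apply: IH; rewrite (offset_sub le_ts).
rewrite ltn_neqAle (leq_trans (leq_subr _ _) le_sm) andbT.
apply: contra ne => /eqP e.
have e0 : offset l k t = 0%N by move: le_ts le_sm e; lia.
have es : offset l k s = offset l k m by move: e; rewrite e0 subn0.
rewrite xpair_eqE (offset_inj es) eqxx andbT eq_sym.
by move: (offset_gt0 k t); rewrite e0; case: eqVneq.
Qed.

(** Induction on the arc length, comparing ranks of [arc_quot]. If D or D' has a root in block (k,
    m), then h is scalar on this arc, hence elements of [Jh h] vanish in the quotient; otherwise
    both counts are zero. *)
Lemma orbit_block_count h D D' x y : rook_placement b D -> rook_placement b D' ->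
    (forall gam, gam \in D -> h \in Hroot F b gam) ->
    (forall gam, gam \in D' -> h \in Hroot F b gam) ->
    X_ D - uval x * X_ D' * uval y \in Jh h ->
  forall k m, block_count b D k m = block_count b D' k m.
Proof.
move=> rD rD' hD hD' Jdiff k m.
have [r] := ubnP (offset l k m); elim: r k m => // r IHr k m le_r.
have same0 D0 t : rook_placement b D0 -> block_count b D0 t t = 0%N.
  case/rookP=> Dr _ _; apply/eqP; rewrite -leqn0 leqNgt; apply/negP.
  by case/block_count_gt0=> gam /Dr/eqP ne [e e']; rewrite e e' in ne.
have [-> | nkm] := eqVneq k m; first by rewrite !same0.
case: (posnP (block_count b D k m + block_count b D' k m)) => [/eqP|pos].
  by rewrite addn_eq0 => /andP[/eqP-> /eqP->].
have [[p q] Hh /= [e1 e2]] : exists2 gam, h \in Hroot F b gam & b gam.1 = k /\ b gam.2 = m.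
  have [] : (0 < block_count b D k m)%N \/ (0 < block_count b D' k m)%N.
  - by move: pos; rewrite addn_gt0 => /orP.
  - by case/block_count_gt0=> gam Dg e; exists gam; [apply: hD|].
  - by case/block_count_gt0=> gam Dg e; exists gam; [apply: hD'|].
have eq_quot : arc_quot k m (X_ D) = arc_quot k m (uval x * X_ D' * uval y).
  have [Ju J0] := JhP _ _ Jdiff.
  apply/matrixP=> i j; rewrite [LHS]mxE [RHS]mxE; case: ifP => // /andP[le_ij le_jm].
  apply/eqP; rewrite -subr_eq0 -glaBE; apply/eqP.
  have [eij | nij] := eqVneq (b i) (b j); first by rewrite (uaP _ Ju).
  apply: (J0 _ _ nij); move: Hh; apply: Hroot_sub; rewrite ?e1 ?e2.
  - by rewrite cyc_offset_l.
  - by rewrite cyc_offset_l.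
  - exact: nkm.
  - exact: nij.
have := congr1 mxrank eq_quot; rewrite rank_arc_quot_orbit !rank_arc_quot_X_ //.
apply: arc_roots_block_count => t s lt_ts; apply: IHr; exact: leq_trans lt_ts le_r.
Qed.

Lemma Jh1 : Jh (1%g : gT) = [set 0].
Proof.
apply/setP=> Z; apply/JhP/set1P=> [[/uaP Zu Z0]|->]; last first.
  by split=> [|*]; rewrite ?ua0 ?gla0E.
apply: glaP => i j; rewrite gla0E; have [/Zu//|ne] := eqVneq (b i) (b j).
exact/Z0/group1.
Qed.

Lemma orbit_Wequiv h D D' x y : rook_placement b D -> rook_placement b D' ->
    h \in HD F b D -> h \in HD F b D' ->
    X_ D - uval x * X_ D' * uval y \in Jh h -> Wequiv b D D'.
Proof.
move=> rD rD' /setIP[_ /bigcapP hD] /setIP[_ /bigcapP hD'] J.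
by apply: block_count_Wequiv => // k m; apply: orbit_block_count J k m.
Qed.

End RookUniqueness.

(** * The trace form on u^a and the functionals Lambda_D *)

Section Duality.

Variables (F : finFieldType) (n l : nat) (b : 'I_n.+1 -> 'I_l).
Local Notation A := (gla F b).
Local Notation gT := {unit gla F b}.
Local Notation root := ('I_n.+1 * 'I_n.+1)%type.
Implicit Types (X Y Z : A) (g h x y : gT) (D : {set root}) (gam : root).
Local Notation ua := (@ua F n l b).
Local Notation X_ := (@X_ F n l b).
Local Notation Lambda := (@Lambda F n l b).

Lemma root_vec_ua i j : b i != b j -> root_vec F b (i, j) \in ua.
Proof.
move=> nij; apply/uaP=> r s ers; rewrite root_vecE /=.
case: (r =P i) => //= er; case: (s =P j) => //= es.
by case/eqP: nij; rewrite -er -es.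
Qed.

(* The trace form identifies (u^a)^* with u^a as a bimodule: in cyclic order,
   i -> s -> j amounts to j -> i -> s. *)
Definition ua_form Y X : F := \sum_i \sum_j Y j i * X i j.

Lemma ua_formC Y X : ua_form Y X = ua_form X Y.
Proof.
rewrite /ua_form exchange_big; apply: eq_bigr => i _; apply: eq_bigr => j _.
exact: mulrC.
Qed.

Lemma ua_formM Y Z X : Y \in ua -> X \in ua -> ua_form Y (Z * X) = ua_form (Y * Z) X.
Proof.
move=> /uaP Yu /uaP Xu; rewrite /ua_form.
under eq_bigr => i _ do under eq_bigr => j _ do rewrite glaME big_mkcond mulr_sumr.
under [RHS]eq_bigr => i _ do under eq_bigr => j _ do rewrite glaME big_mkcond mulr_suml.
rewrite exchange_big [RHS]exchange_big; apply: eq_bigr => j _ /=.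
rewrite exchange_big; apply: eq_bigr => s _; apply: eq_bigr => i _.
(* The two cases excluded by [cyc_rot] contribute zero, as Y and X have zero diagonal blocks. *)
have [e | nij] := eqVneq (b i) (b j).
  by rewrite Yu ?e // mul0r; case: ifP; rewrite !mul0r.
have [e | nsj] := eqVneq (b s) (b j).
  by rewrite Xu // !mulr0; case: ifP; rewrite !mulr0.
by rewrite cyc_rot //; case: ifP => _; rewrite ?mulr0 ?mul0r // mulrA.
Qed.

Lemma ua_form_inj Y Y' : Y \in ua -> Y' \in ua ->
  (forall X, X \in ua -> ua_form Y X = ua_form Y' X) -> Y = Y'.
Proof.
move=> /uaP Yu /uaP Yu' eYY'; apply: glaP => i j.
have [e | nij] := eqVneq (b i) (b j); first by rewrite Yu ?Yu'.
have form_rv Z : ua_form Z (root_vec F b (j, i)) = Z i j.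
  rewrite /ua_form (bigD1 j) //= (bigD1 i) //= !mxE !eqxx mulr1.
  rewrite !big1 ?addr0 // => [r /negPf ne | r /negPf ne].
    by rewrite big1 // => s _; rewrite mxE ne mulr0.
  by rewrite mxE ne andbF mulr0.
by rewrite -!form_rv eYY' // root_vec_ua // eq_sym.
Qed.

(** The trace form pairs position (i, j) with (j, i), so Lambda_D is represented by X_D for the
    transposed roots. *)
Definition transpose D : {set root} := [set (gam.2, gam.1) | gam in D].

Lemma mem_transpose D i j : ((i, j) \in transpose D) = ((j, i) \in D).
Proof. by apply/imsetP/idP => [[[p q] Dpq [-> ->]]|] //; exists (j, i). Qed.

Lemma rook_transpose D : rook_placement b D -> rook_placement b (transpose D).
Proof.
case/rookP=> Dr i1 i2; apply/rookP; split.
- by case=> i j; rewrite mem_transpose => /Dr; rewrite eq_sym.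
- case=> i j [i' j']; rewrite !mem_transpose => Dij Dij' /= e.
  by have [-> ->] := i2 _ _ Dij Dij' e.
- case=> i j [i' j']; rewrite !mem_transpose => Dij Dij' /= e.
  by have [-> ->] := i1 _ _ Dij Dij' e.
Qed.

Lemma block_count_transpose D k m :
  block_count b (transpose D) k m = block_count b D m k.
Proof.
have inj : injective (fun gam : root => (gam.2, gam.1)) by move=> [? ?] [? ?] [-> ->].
rewrite /block_count -[in RHS](card_imset _ inj); apply: eq_card => -[i j].
rewrite inE mem_transpose; apply/idP/imsetP => [/and3P[Dij ei ej]|[[p q] /setIdP[Dpq e] [-> ->]]].
  by exists (j, i); rewrite // inE Dij /= ei ej.
by rewrite Dpq /= andbC.
Qed.

Lemma Lambda_form D X : Lambda D X = ua_form (X_ (transpose D)) X.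
Proof.
rewrite /Lambda big_mkcond /ua_form pair_bigA /=; apply: eq_bigr => -[i j] _ /=.
by rewrite X_E mem_transpose; case: ifP; rewrite ?mul1r ?mul0r.
Qed.

(** The form turns X |-> Lambda_D (x X y) into the element y X_T x, T the transpose of D. Equal
    functionals give equal elements, and uniqueness for orbits in u^a applies with h = 1. *)
Lemma Lambda_orbit_Wequiv D D' x y x' y' : rook_placement b D -> rook_placement b D' ->
  (forall X, X \in ua -> Lambda D (uval x * X * uval y) = Lambda D' (uval x' * X * uval y')) ->
  Wequiv b D D'.
Proof.
move=> rD rD' eL; apply: block_count_Wequiv => // k m.
rewrite -!(block_count_transpose _ m k); apply: Wequiv_block_count.
have rT := rook_transpose rD; have rT' := rook_transpose rD'.
have move_form D0 x0 y0 X : rook_placement b (transpose D0) -> X \in ua ->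
    Lambda D0 (uval x0 * X * uval y0) = ua_form (uval y0 * X_ (transpose D0) * uval x0) X.
  move=> r0 Xu; have Tu := X_ua F r0; rewrite Lambda_form -mulrA.
  rewrite ua_formM ?ua_mulr // ua_formC -ua_formM ?ua_mulr // ua_formC.
  by rewrite mulrA.
have e : uval y * X_ (transpose D) * uval x = uval y' * X_ (transpose D') * uval x'.
  apply: ua_form_inj => [||X Xu]; try by apply/ua_mulr/ua_mull/X_ua.
  by rewrite -!move_form // eL.
apply: (@orbit_Wequiv F _ _ _ 1%g _ _ (y^-1 * y')%g (x' * x^-1)%g) => //.
rewrite !uvalM -!mulrA [_ * (uval x' * _)]mulrA [uval y' * _]mulrA [uval y' * _]mulrA -e.
by rewrite -!mulrA -uvalM mulgV uval1 mulr1 uvalVK subrr Jh0.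
Qed.

(** Lambda_D reads only coordinates at roots of D, and all of these vanish on [Jh h] when h is in
    H_D. *)
Lemma Lambda_Jh D h Z : rook_placement b D -> h \in HD F b D -> Z \in Jh h ->
  Lambda D Z = 0.
Proof.
case/rookP=> Dr _ _ /setIP[_ /bigcapP hD] /JhP[_ ZJ]; apply: big1 => -[i j] Dij.
by rewrite ZJ ?hD //; apply: Dr Dij.
Qed.

Lemma LambdaZ D c X : Lambda D (c *: X) = c * Lambda D X.
Proof. by rewrite /Lambda mulr_sumr; apply: eq_bigr => gam _; rewrite glaZE. Qed.

(** A nonzero coordinate of X in S(gam) is moved to gam by a matrix unit on the right, and the rook
    condition keeps the other roots of D silent. Together with [Lambda_uDM] this describes u^a_D as
    the set of X in u^a with Lambda_D (X u^a) = 0. *)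
Lemma Lambda_detect D X : rook_placement b D -> X \in ua -> X \notin uD F b D ->
  exists2 Z, Z \in ua & Lambda D (X * Z) != 0.
Proof.
case/rookP=> Dr i1 i2 Xu nX.
have /exists_inP[gam Dg /exists_inP[al Sal Xal]] :
    [exists gam in D, exists al in Sroot b gam, X al.1 al.2 != 0].
  apply: contraR nX => /exists_inPn nex; apply/uDP; split; first exact/uaP.
  by move=> gam al /nex/exists_inPn/(_ al) h /h; rewrite negbK => /eqP.
have [/setIdP[_ /andP[/eqP e1 S]] Dgr] := (Sal, Dr _ Dg).
have [n2 c2] : b al.2 != b gam.2 /\ cyc (b gam.1) (b al.2) (b gam.2).
  move: S Dgr; rewrite /cyc -!val_eqE /=.
  case: (ltngtP (b gam.1) (b gam.2)) => //= lt12.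
    by case/andP=> lt1 lt2 _; rewrite (ltnW lt1) (ltnW lt2) neq_ltn lt2.
  case/orP=> lt _; first by rewrite (ltnW lt) orbT neq_ltn lt.
  by rewrite (ltnW lt) neq_ltn (ltn_trans lt12 lt) orbT.
exists (root_vec F b (al.2, gam.2)); first exact: root_vec_ua.
rewrite /Lambda (bigD1 gam) //= big1 => [|gam' /andP[Dg' ne]].
  by rewrite addr0 mul_root_vecr eqxx c2 /= -e1.
rewrite mul_root_vecr; case: eqP => //= e2.
by case/eqP: ne; apply: i2.
Qed.

End Duality.

(** * Conjugacy in L against conjugacy in H_D *)

Section BlockRestriction.

Variables (F : finFieldType) (n l : nat) (b : 'I_n.+1 -> 'I_l).
Local Notation A := (gla F b).
Local Notation gT := {unit gla F b}.
Local Notation root := ('I_n.+1 * 'I_n.+1)%type.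
Implicit Types (X Y Z : A) (g h m : gT) (D : {set root}) (gam : root).
Local Notation Lset := (@Lset F n l b).

(* X is block diagonal in all uses, so it suffices to test the row block: X keeps its
   blocks at the positions in S, the other diagonal blocks become the identity. *)
Definition block_restr_mx (S : pred 'I_l) X : A :=
  Gla b (\matrix_(i, j) (if S (b i) then X i j else (i == j)%:R)).

Lemma block_restr_mxE S X i j :
  block_restr_mx S X i j = if S (b i) then X i j else (i == j)%:R.
Proof. by rewrite mxE. Qed.

Lemma block_restr_mxM S g h : g \in Lset -> h \in Lset ->
  block_restr_mx S (uval g) * block_restr_mx S (uval h) = block_restr_mx S (uval (g * h)%g).
Proof.
move=> Lg Lh; apply: glaP => i j; rewrite glaME block_restr_mxE big_mkcond.
case: ifP => Si.
  rewrite uvalM umulL_l // [RHS]big_mkcond; apply: eq_bigr => s _.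
  rewrite !block_restr_mxE Si; case: (eqVneq (b s) (b i)) => [->|ne].
    by rewrite cyc_l Si.
  by rewrite (uval_L Lg) 1?eq_sym // mul0r if_same.
rewrite (bigD1 i) //= big1 => [|s /negPf ne].
  by rewrite cyc_l !block_restr_mxE Si eqxx mul1r addr0.
by rewrite block_restr_mxE Si eq_sym ne mul0r if_same.
Qed.

Definition block_restr S g : gT := gla_unit (block_restr_mx S (uval g)).

Lemma uval_block_restr S g : g \in Lset -> uval (block_restr S g) = block_restr_mx S (uval g).
Proof.
have r1 : block_restr_mx S (uval (1%g : gT)) = 1.
  by apply: glaP => i j; rewrite block_restr_mxE uval1 gla1E if_same.
move=> Lg; apply: uval_gla_unit; apply/unitrP; exists (block_restr_mx S (uval g^-1%g)).
by rewrite !block_restr_mxM ?groupV // mulVg mulgV r1.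
Qed.

Lemma block_restr_L S g : g \in Lset -> block_restr S g \in Lset.
Proof.
move=> Lg; apply/LsetP=> i j ne; rewrite uvalE uval_block_restr // block_restr_mxE.
by case: ifP => _; [rewrite (uval_L Lg) | case: (i =P j) ne => [->|]; rewrite ?eqxx].
Qed.

Lemma block_restr_split S g : g \in Lset ->
  (block_restr S g * block_restr (predC S) g)%g = g.
Proof.
move=> Lg; apply: uval_inj; rewrite uvalM !uval_block_restr //.
apply: glaP => i j; rewrite glaME big_mkcond.
case Si: (S (b i)); last first.
  rewrite (bigD1 i) //= big1 => [|s /negPf ne].
    by rewrite cyc_l !mxE /= Si /= eqxx mul1r addr0.
  by rewrite mxE Si eq_sym ne mul0r if_same.
rewrite (bigD1 j) //= big1 => [|s /negPf ne].
  have [e|nij] := eqVneq (b i) (b j); last first.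
    by rewrite cyc_r !mxE Si (uval_L Lg) // mul0r addr0.
  by rewrite cyc_r !mxE /= -e Si /= eqxx mulr1 addr0.
have [e|nis] := eqVneq (b i) (b s).
  by rewrite !mxE /= -e Si /= ne mulr0 if_same.
by rewrite mxE Si (uval_L Lg) // mul0r if_same.
Qed.

Definition in_arcs D : pred 'I_l := fun t => [exists gam in D, @Defs.arc n l b gam t].

Lemma block_restr_HD D m : m \in Lset -> block_restr (predC (in_arcs D)) m \in HD F b D.
Proof.
move=> Lm; rewrite inE block_restr_L //; apply/bigcapP=> gam Dg; apply/uHrootP.
split; first exact: block_restr_L.
exists 1 => i j ai _; rewrite uval_block_restr // block_restr_mxE /= ifF //.
by apply/negbTE; rewrite negbK; apply/exists_inP; exists gam.
Qed.

Lemma block_restr_comm D h m : h \in HD F b D -> m \in Lset ->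
  (h ^ block_restr (in_arcs D) m)%g = h.
Proof.
move=> Hh Lm; have Lh : h \in Lset by case/setIP: Hh.
have LR := block_restr_L (in_arcs D) Lm.
apply/conjg_fixP/commgP; apply: uval_inj; rewrite !uvalM; apply: glaP => i j.
have [/exists_inP[gam Dg ai] | nS] := boolP (in_arcs D (b i)).
  have [c [hl hr]] := Hroot_scal (bigcapP (proj2 (setIP Hh)) _ Dg).
  rewrite hl //; have [e|nij] := eqVneq (b i) (b j); first by rewrite hr -?e.
  rewrite (uval_L LR) // mulr0 umulL_l // big1 // => s /eqP e.
  by rewrite (uval_L Lh) ?mulr0 // e.
have RE s t : b s = b i -> uval (block_restr (in_arcs D) m) s t = (s == t)%:R.
  by move=> e; rewrite uval_block_restr // block_restr_mxE e (negPf nS).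
transitivity (uval h i j).
  rewrite umulL_l // big_mkcond (bigD1 j) //= big1 => [|s /negPf ne].
    rewrite addr0; case: eqP => [e|/eqP ne]; first by rewrite RE // eqxx mulr1.
    by rewrite (uval_L Lh) // eq_sym.
  by case: eqP => // e; rewrite RE // ne mulr0.
rewrite umulL_l // (bigD1 i) //= big1 => [|s /andP[/eqP e /negPf ne]].
  by rewrite RE // eqxx mul1r addr0.
by rewrite RE // eq_sym ne mul0r.
Qed.

(** The factor of m supported on the arcs of D commutes with h, which is scalar there; the remaining
    factor is the identity on these arcs and so lies in H_D. *)
Lemma HD_conj_restr D h m : h \in HD F b D -> m \in Lset ->
  (h ^ m)%g = (h ^ block_restr (predC (in_arcs D)) m)%g.
Proof.
move=> Hh Lm; rewrite -{1}(block_restr_split (in_arcs D) Lm) conjgM.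
by rewrite block_restr_comm.
Qed.

Lemma HD_cfunJ D (theta : 'CF(HD F b D)) h m : m \in Lset -> theta (h ^ m)%g = theta h.
Proof.
move=> Lm; have [Hh | nHh] := boolP (h \in HD F b D); last first.
  by rewrite !cfun0 ?HD_conjE.
by rewrite (HD_conj_restr Hh Lm) cfunJ ?block_restr_HD.
Qed.

Lemma HD_class D h : h \in HD F b D -> (h ^: Lset)%g = (h ^: HD F b D)%g.
Proof.
move=> Hh; apply/setP=> g; apply/imsetP/imsetP=> -[m Lm ->]; last first.
  by exists m => //; case/setIP: Lm.
exists (block_restr (predC (in_arcs D)) m); first exact: block_restr_HD.
exact: HD_conj_restr Hh Lm.
Qed.

End BlockRestriction.


(** * Tools on characters, conjugation identities and additive characters *)

Lemma cfdot_eq0_disjoint (gT : finGroupType) (G : {group gT}) (phi psi : 'CF(G)) :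
  phi \is a character -> psi \is a character -> '[phi, psi] = 0 ->
  disjoint_characters phi psi.
Proof.
(* The inner product is a sum of products of multiplicities, all nonnegative, so each product
   vanishes. *)
move=> Nphi Npsi; rewrite cfdot_sum_irr => /eqP; rewrite psumr_eq0 => [/allP dot0|i _].
  apply/pred0P=> i /=; apply/negbTE/negP; rewrite !irr_consttE => /andP[nphi npsi].
  have /implyP/(_ isT) := dot0 i (mem_index_enum _).
  by rewrite mulf_eq0 fmorph_eq0 (negPf nphi) (negPf npsi).
by rewrite mulr_ge0 ?conj_natr ?natr_ge0 ?Cnat_cfdot_char_irr.
Qed.

(** First orthogonality relation across an equality of groups. The indices have different types,
    hence distinctness is expressed through values. *)
Lemma sum_irr_distinct (gT : finGroupType) (G H : {group gT}) (i : Iirr G) (j : Iirr H) :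
    G = H -> (exists x, 'chi_i x != 'chi_j x) ->
  \sum_(x in G) 'chi_i x * ('chi_j x)^* = 0.
Proof.
move=> eGH; case: _ / eGH in j * => -[x ne]; have := cfdot_irr i j.
rewrite cfdotE; case: eqP => [e | _ /eqP]; first by rewrite e eqxx in ne.
by rewrite mulf_eq0 invr_eq0 (negPf (neq0CG _)) => /eqP.
Qed.

(** This and the next three identities serve to compare the nilpotent parts of g and of its
    conjugates in [nilpart_conj]. *)
Lemma conj_decomp (gT : finGroupType) (h k y : gT) :
  ((h ^ k)^-1 * y^-1 * h = k^-1 * h^-1 * ((k * y^-1) * h))%g /\
  (y^-1 = k^-1 * h^-1 * (h * (k * y^-1)))%g.
Proof.
by rewrite /conjg !invMg !invgK !mulgA mulgKV mulVg mul1g.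
Qed.

Lemma conj_decomp2 (gT : finGroupType) (h k u y : gT) :
  ((h ^ k)^-1 * (h * u) ^ y = (h ^ k)^-1 * y^-1 * h * (u * y))%g.
Proof. by rewrite /conjg !mulgA. Qed.

Lemma commutator_1D (R : pzRingType) (V H : R) :
  (1 + V) * H - H * (1 + V) = - (H * V - V * H).
Proof. by rewrite mulrDl mulrDr mul1r mulr1 opprD opprB addrACA subrr add0r. Qed.

Lemma nilpart_conj_aux (R : pzRingType) (T P X Y N : R) :
  P * Y = 1 -> N = T * ((1 + X) * Y) - 1 -> N - P * X * Y = (T - P) * ((1 + X) * Y).
Proof.
move=> PY ->; rewrite mulrBl -addrA -opprD; congr (_ - _).
by rewrite mulrDl mul1r mulrDr PY mulrA.
Qed.

Section AdditiveCharacter.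

Variables (F : finFieldType) (eps : addchar F).

Lemma addchar_neq0 t : eps t != 0.
Proof.
apply/eqP=> e; have /eqP := addcharD eps t (- t).
by rewrite subrr addchar0 e mul0r oner_eq0.
Qed.

Lemma addcharN t : eps (- t) = (eps t)^-1.
Proof.
apply: (mulfI (addchar_neq0 t)).
by rewrite -addcharD subrr addchar0 divff ?addchar_neq0.
Qed.

(** The values are p-th roots of unity for p the characteristic, so conjugation is inversion. *)
Lemma addchar_conj t : (eps t)^* = eps (- t).
Proof.
have [p p_pr pF] := finPcharP F.
have epsMn k : eps (t *+ k) = eps t ^+ k.
  by elim: k => [|k IHk]; rewrite ?addchar0 // mulrS addcharD IHk exprS.
have /eqP norm1 : `|eps t| == 1.
  rewrite -(pexpr_eq1 (prime_gt0 p_pr)) ?normr_ge0 // -normrX -epsMn.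
  by rewrite (mulrn_pchar pF) addchar0 normr1.
by rewrite addcharN invC_norm norm1 expr1n invr1 mul1r.
Qed.

End AdditiveCharacter.

(** * The formula for the values of chi *)

Section Values.

Variables (F : finFieldType) (eps : addchar F).
Hypothesis eps_nontrivial : exists t : F, eps t != 1.
Variables (n l : nat) (b : 'I_n.+1 -> 'I_l).
Local Notation A := (gla F b).
Local Notation gT := {unit gla F b}.
Local Notation root := ('I_n.+1 * 'I_n.+1)%type.
Implicit Types (X Y Z : A) (g h x y : gT) (D : {set root}) (gam : root).
Local Notation Lset := (@Lset F n l b).
Local Notation ua := (@ua F n l b).
Local Notation Lambda := (@Lambda F n l b).

Lemma sum_addchar_ua (f : A -> F) : {morph f : X Y / X + Y} ->
    (forall c X, f (c *: X) = c * f X) ->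
  \sum_(X in ua) eps (f X) = if [exists X in ua, f X != 0] then 0 else #|ua|%:R.
Proof.
move=> fD fZ; case: ifPn => [/exists_inP[Z Zu nZ] | /exists_inPn f0]; last first.
  rewrite -sumr_const; apply: eq_bigr => X /f0; rewrite negbK => /eqP->.
  exact: addchar0.
(* Translation by Y, where f Y = t, multiplies the sum by eps t, which differs from 1; so the sum is
   zero. *)
have [t nt] := eps_nontrivial; pose Y := (t / f Z) *: Z.
have Yu : Y \in ua by apply/uaP=> i j e; rewrite glaZE (uaP _ Zu) ?mulr0.
have fY : f Y = t by rewrite fZ divfK.
apply/eqP; move: nt; rewrite -subr_eq0 => nt.
rewrite -(mulrI_eq0 _ (mulfI nt)) mulrBl mul1r subr_eq0; apply/eqP.
rewrite mulr_sumr [RHS](reindex_inj (addrI Y)) /=; apply: eq_big => X.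
  apply/idP/idP => [/(uaD Yu)//|YXu].
  by rewrite -[X](addKr Y) uaD ?uaN.
by rewrite fD addcharD fY.
Qed.

Lemma mem_GD_LU D h X : h \in Lset -> X \in ua ->
  (h * Upart X)%g \in GD F b D = (h \in HD F b D) && (X \in uD F b D).
Proof.
move=> Lh Xu; apply/mulsgP/andP => [[k u Hk Uu e]|[Hh XD]]; last first.
  by exists h (Upart X); rewrite // UDE uvalE uval_Upart // addrC addKr.
have Lk : k \in Lset by case/setIP: Hk.
rewrite UDE uvalE in Uu.
have Vu : uval u - 1 \in ua by case/setIdP: Uu.
have eu : u = Upart (uval u - 1).
  by apply: uval_inj; rewrite uval_Upart // addrC subrK.
rewrite -(Lpart_LU Lh Xu) -{2}(nilpart_LU Lh Xu) e eu.
by rewrite Lpart_LU // nilpart_LU.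
Qed.

Lemma xi_LU D (theta : 'CF(HD F b D)) p h X : h \in Lset -> X \in ua ->
  xi eps theta p (h * Upart X)%g =
    if X \in uD F b D then theta h * eps (Lambda D (X * uval p)) else 0.
Proof.
move=> Lh Xu; have [Hh | nHh] := boolP (h \in HD F b D); last first.
  by rewrite !cfun0 ?mem_GD_LU ?(negPf nHh) // mul0r if_same.
case: ifPn => XD; last by rewrite cfun0 // mem_GD_LU // (negPf XD) andbF.
rewrite xiE //; last by rewrite UDE uvalE uval_Upart // addrC addKr.
by rewrite /lact !uvalE uval_Upart // [1 + X]addrC addrK.
Qed.

Lemma uD_mulrE D X x : (X * uval x \in uD F b D) = (X \in uD F b D).
Proof.
apply/idP/idP; last exact: uD_mulr.
by move/(uD_mulr (uval x^-1%g)); rewrite -mulrA -uvalM mulgV uval1 mulr1.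
Qed.

(* The indicator function of u^a_D is the average over z in u^a of
   eps (Lambda_D (X z)), which linearizes the restriction to G^a_D. *)
Lemma sum_xi_LU D (theta : 'CF(HD F b D)) h X : rook_placement b D ->
    h \in Lset -> X \in ua ->
  (\sum_(p in Lset) xi eps theta p) (h * Upart X)%g =
    theta h * (#|ua|%:R^-1 * \sum_y eps (Lambda D (X * uval y))).
Proof.
(* Writing y = p (1 + Z) splits the sum over the group into the sum over p in L and an average over
   Z in u^a. *)
move=> rD Lh Xu; rewrite sum_cfunE big_LU !mulr_sumr; apply: eq_bigr => p Lp.
have Xpu : X * uval p \in ua by apply: ua_mulr.
transitivity (theta h * (#|ua|%:R^-1 * (eps (Lambda D (X * uval p)) *
    \sum_(Z in ua) eps (Lambda D (X * uval p * Z))))); last first.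
  congr (_ * (_ * _)); rewrite mulr_sumr; apply: eq_bigr => Z Zu.
  by rewrite uvalM uval_Upart // mulrA mulrDr mulr1 LambdaD addcharD.
rewrite sum_addchar_ua => [|Z Z'|c Z]; last 2 first.
- by rewrite mulrDr LambdaD.
- by rewrite -scalerAr LambdaZ.
have n0 : #|ua|%:R != 0 :> algC.
  by rewrite pnatr_eq0 -lt0n; apply/card_gt0P; exists 0; apply: ua0.
rewrite xi_LU // -(uD_mulrE _ _ p).
have [XD | nXD] := boolP (X * uval p \in uD F b D).
  rewrite ifF ?[_^-1 * _]mulrC -?mulrA ?mulfV ?mulr1 //.
  by apply/exists_inP=> -[Z Zu]; rewrite Lambda_uDM ?eqxx.
have [Z Zu nz] := Lambda_detect rD Xpu nXD.
by rewrite ifT ?mulr0 //; apply/exists_inP; exists Z.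
Qed.

(** The double orbit sum through which chi depends on the nilpotent part; it is constant on the
    orbits of X and, for h in H_D, on cosets of u^a_h. *)
Definition Phi D X : algC := \sum_x \sum_y eps (Lambda D (uval x * X * uval y)).

Lemma Phi_orbit D X x y : Phi D (uval x * X * uval y) = Phi D X.
Proof.
rewrite /Phi [RHS](reindex_inj (mulIg x)); apply: eq_bigr => x' _.
rewrite [RHS](reindex_inj (mulgI y)); apply: eq_bigr => y' _.
by rewrite !uvalM !mulrA.
Qed.

Lemma Phi_Jh D h X Z : rook_placement b D -> h \in HD F b D -> Z \in Jh h ->
  Phi D (X + Z) = Phi D X.
Proof.
move=> rD Hh JZ; apply: eq_bigr => x _; apply: eq_bigr => y _.
have e : Lambda D (uval x * Z * uval y) = 0.
  by apply: (Lambda_Jh rD Hh); apply/Jh_mulr/Jh_mull.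
by rewrite mulrDr (mulrDl (uval x * X)) LambdaD [X in _ + X]e addr0.
Qed.

Lemma LpartJ g y : Lpart (g ^ y)%g = (Lpart g ^ Lpart y)%g.
Proof. by rewrite /conjg !LpartM LpartV. Qed.

(** Moving y^-1 past the L-part h of g costs a commutator of h with an element of u^a, which lies in
    [Jh h]. Modulo this ideal, conjugation therefore acts on X by X |-> y^-1 X y. *)
Lemma nilpart_conj g y :
  nilpart (g ^ y)%g - uval y^-1%g * nilpart g * uval y \in Jh (Lpart g).
Proof.
set h := Lpart g; set X := nilpart g; set k := Lpart y.
have Lh : h \in Lset by apply: Lpart_in.
have eg : g = (h * Upart X)%g by apply: LU_partE.
pose V := nilpart y^-1%g; have Vu : V \in ua by apply: nilpart_in.
have eV : uval (k * y^-1)%g = 1 + V by rewrite /V /nilpart LpartV invgK addrC subrK.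
pose W := uval ((h ^ k)^-1 * y^-1 * h)%g - uval y^-1%g.
have JW : W \in Jh h.
  have -> : W = uval (k^-1 * h^-1)%g * - (uval h * V - V * uval h).
    have [e1 e2] := conj_decomp h k y.
    rewrite /W e1 [X in _ - uval X]e2.
    rewrite uvalM [X in _ - X]uvalM -mulrBr; congr (_ * _).
    rewrite [X in X - _]uvalM [X in _ - X]uvalM eV; exact: commutator_1D.
  by apply/Jh_mull/JhN/Jh_comm.
have Xu : X \in ua by apply: nilpart_in.
pose T := uval ((h ^ k)^-1 * y^-1 * h)%g.
have eN : nilpart (g ^ y)%g = T * (uval (Upart X) * uval y) - 1.
  rewrite /nilpart; congr (_ - _); rewrite /T -!uvalM; congr uval.
  by rewrite LpartJ -/h -/k {1}eg; apply: conj_decomp2.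
rewrite (uval_Upart Xu) in eN.
have PY : uval y^-1%g * uval y = 1 by rewrite -uvalM mulVg uval1.
rewrite (nilpart_conj_aux PY eN); exact: Jh_mulr JW.
Qed.

Lemma chi_value (alpha : charIndex F b) g : rook_placement b (tag alpha) ->
  chi eps alpha g = #|GD F b (tag alpha)|%:R^-1 * #|ua|%:R^-1 *
    ('chi_(tagged alpha) (Lpart g) * Phi (tag alpha) (nilpart g)).
Proof.
case: alpha => D i /= rD; rewrite /chi /= cfIndE ?subsetT // -mulrA; congr (_ * _).
set theta := 'chi_i; rewrite mulrCA.
have step y : (\sum_(p in Lset) xi eps theta p) (g ^ y)%g =
    theta (Lpart g) * (#|ua|%:R^-1 *
      \sum_z eps (Lambda D (uval y^-1%g * nilpart g * uval (y * z)%g))).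
  rewrite [in LHS](LU_partE (g ^ y)%g) sum_xi_LU ?Lpart_in ?nilpart_in //.
  rewrite LpartJ HD_cfunJ ?Lpart_in //.
  (* Off H_D the character theta is zero; on H_D the functional Lambda_D kills the error term of
     [nilpart_conj]. *)
  have [Hh | nHh] := boolP (Lpart g \in HD F b D); last by rewrite cfun0 // !mul0r.
  congr (_ * (_ * _)); apply: eq_bigr => z _; congr (eps _).
  rewrite -[nilpart (g ^ y)%g](subrK (uval y^-1%g * nilpart g * uval y)) mulrDl LambdaD.
  rewrite (Lambda_Jh rD Hh) ?add0r ?uvalM ?mulrA //.
  by apply: Jh_mulr; apply: nilpart_conj.
rewrite (eq_bigr _ (fun y _ => step y)) -!mulr_sumr; congr (_ * (_ * _)).
rewrite (eq_bigl xpredT) => [|y]; last by rewrite in_setT.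
rewrite /Phi (reindex_inj invg_inj) /=; apply: eq_bigr => x _.
rewrite [RHS](reindex_inj (mulgI x^-1)%g) /=; apply: eq_bigr => y _.
by rewrite invgK.
Qed.

End Values.

Lemma mulg_conj_swap (gT : finGroupType) (h u k v : gT) :
  (h * u * (k * v) = h * k * (u ^ k * v))%g.
Proof. by rewrite /conjg !mulgA mulgK. Qed.

Lemma mulr_regroup (R : comPzRingType) (c c' t t' p p' : R) :
  c * (t * p) * (c' * (t' * p')) = c * c' * (t * t' * (p * p')).
Proof. by rewrite mulrACA [t * p * _]mulrACA. Qed.

(** * The functions chi are characters, nonzero and pairwise orthogonal *)

Section Supercharacters.

Variables (F : finFieldType) (eps : addchar F).
Hypothesis eps_nontrivial : exists t : F, eps t != 1.
Variables (n l : nat) (b : 'I_n.+1 -> 'I_l).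
Local Notation A := (gla F b).
Local Notation gT := {unit gla F b}.
Local Notation root := ('I_n.+1 * 'I_n.+1)%type.
Implicit Types (X Y Z : A) (g h x y : gT) (D : {set root}) (gam : root).
Local Notation Lset := (@Lset F n l b).
Local Notation ua := (@ua F n l b).
Local Notation Lambda := (@Lambda F n l b).

Local Notation Phi := (@Phi F eps n l b).
Local Notation mu := (@Defs.mu F n l b).

Lemma xi_fun_lin D p :
  mx_repr (GD F b D) (fun g => (xi_fun eps (1 : 'CF(HD F b D)) p g)%:M : 'M[algC]_1).
Proof.
have val1 h u : h \in HD F b D -> u \in UD F b D ->
    xi_fun eps (1 : 'CF(HD F b D)) p (h * u)%g = eps (mu D p u).
  by move=> Hh Uu; rewrite xi_funE // cfun1E Hh mul1r.
split=> [|_ _ /mulsgP[h u Hh Uu ->] /mulsgP[k v Hk Uv ->]].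
  rewrite -[1%g]mulg1 val1 ?group1 // /mu /lact uvalE uval1 subrr mul0r.
  by rewrite -[0](scale0r 0) LambdaZ mul0r addchar0.
have Uuk : (u ^ k)%g \in UD F b D by rewrite memJ_norm // (subsetP (HD_norm_UD F b D)).
have -> : (h * u * (k * v) = h * k * (u ^ k * v))%g.
  exact: mulg_conj_swap.
have Hhk : (h * k)%g \in HD F b D := groupM Hh Hk.
have Uukv : (u ^ k * v)%g \in UD F b D := groupM Uuk Uv.
rewrite (val1 _ _ Hhk Uukv) (val1 _ _ Hh Uu) (val1 _ _ Hk Uv).
by rewrite (mu_M p Uuk Uv) (mu_J p Hk Uu) addcharD scalar_mxM.
Qed.

Lemma UD_HD_sdprod D : (UD F b D ><| HD F b D = GD F b D)%g.
Proof.
have tUH : (UD F b D :&: HD F b D = 1)%g by rewrite setIC HD_UD_trivg.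
by rewrite (sdprodE (HD_norm_UD F b D) tUH) -(normC (HD_norm_UD F b D)).
Qed.

(** The function is the inflation of theta along the projection of G^a_D to H_D, multiplied by the
    linear character obtained for theta = 1. *)
Lemma xi_char D (theta : 'CF(HD F b D)) p :
  theta \is a character -> xi eps theta p \is a character.
Proof.
move=> Ntheta; pose lam := cfRepr (MxRepresentation (xi_fun_lin D p)).
suff -> : xi eps theta p = cfSdprod (UD_HD_sdprod D) theta * lam.
  by rewrite rpredM ?cfSdprod_char ?cfRepr_char.
apply/cfun_inP=> g Gg; have /mulsgP[h u Hh Uu eg] := Gg.
rewrite [RHS]cfunE [lam g]cfunE Gg mulr1n /= mxtrace_scalar eg.
rewrite xiE // xi_funE // cfun1E Hh mul1r cfkerMr ?cfSdprodEr //.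
exact: (subsetP (cfker_sdprod (UD_HD_sdprod D) theta)).
Qed.

Lemma chi_char (alpha : charIndex F b) : chi eps alpha \is a character.
Proof. by apply/cfInd_char/rpred_sum => p _; apply/xi_char/irr_char. Qed.

Lemma Phi0 D : Phi D 0 = (#|[set: gT]| * #|[set: gT]|)%:R.
Proof.
have e x y : eps (Lambda D (uval x * 0 * uval y)) = 1.
  by rewrite mulr0 mul0r -[0](scale0r 0) LambdaZ mul0r addchar0.
rewrite /Phi (eq_bigr (fun _ => #|[set: gT]|%:R)) => [|x _]; last first.
  by rewrite (eq_bigr (fun _ => 1)) => [|y _]; rewrite ?e // sumr_const cardsT.
by rewrite sumr_const -cardsT natrM mulr_natr.
Qed.

Lemma chi_neq0 (alpha : charIndex F b) : rook_placement b (tag alpha) -> chi eps alpha != 0.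
Proof.
move=> rD; apply/eqP=> /cfunP/(_ 1%g)/eqP; rewrite chi_value // cfunE.
rewrite Lpart_id ?group1 // /nilpart Lpart_id ?group1 // mulVg uval1 subrr Phi0.
apply/negP; rewrite !mulf_neq0 ?invr_eq0 ?neq0CG ?irr1_neq0 //.
- by rewrite pnatr_eq0 -lt0n; apply/card_gt0P; exists 0; apply: ua0.
- by rewrite pnatr_eq0 -lt0n muln_gt0 andbb; apply/card_gt0P; exists 1%g; rewrite inE.
Qed.

(** The product expands into terms eps (f X) with f a difference of translates of Lambda_D and
    Lambda_D'. For inequivalent placements no such f vanishes on u^a, so every term sums to zero. *)
Lemma sum_Phi_eq0 D D' : rook_placement b D -> rook_placement b D' ->
  ~~ Wequiv b D D' -> \sum_(X in ua) Phi D X * (Phi D' X)^* = 0.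
Proof.
move=> rD rD' nW.
pose f (u v : gT * gT) X := Lambda D (uval u.1 * X * uval u.2) -
  Lambda D' (uval v.1 * X * uval v.2).
have PhiE D0 X : Phi D0 X = \sum_(u : gT * gT) eps (Lambda D0 (uval u.1 * X * uval u.2)).
  by rewrite /Phi pair_bigA.
have e X : Phi D X * (Phi D' X)^* = \sum_u \sum_v eps (f u v X).
  rewrite !PhiE rmorph_sum big_distrlr; apply: eq_bigr => u _.
  by apply: eq_bigr => v _; rewrite addcharD -addchar_conj.
rewrite (eq_bigr _ (fun X _ => e X)) exchange_big big1 // => u _.
rewrite exchange_big big1 // => v _; rewrite (sum_addchar_ua eps_nontrivial) => [|X Y|c X].
- case: ifPn => // /exists_inPn f0; case/negP: nW.
  apply: (@Lambda_orbit_Wequiv F _ _ _ D D' u.1 u.2 v.1 v.2) => // X Xu.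
  by apply/eqP; rewrite -subr_eq0; have := f0 X Xu; rewrite negbK.
- rewrite /f [uval u.1 * _]mulrDr [(_ + _) * uval u.2]mulrDl LambdaD.
  by rewrite [uval v.1 * _]mulrDr [(_ + _) * uval v.2]mulrDl LambdaD opprD addrACA.
- by rewrite /f -!scalerAr -!scalerAl !LambdaZ mulrBr.
Qed.

Lemma HD_Wequiv D D' : Wequiv b D D' -> HD F b D = HD F b D'.
Proof.
have sub D1 D2 : Wequiv b D1 D2 -> HD F b D1 \subset HD F b D2.
  case/exists_inP=> w1; rewrite inE => /forallP W1 /exists_inP[w2].
  rewrite inE => /forallP W2 /eqP->; apply/subsetP=> h /setIP[Lh /bigcapP hD].
  rewrite inE Lh; apply/bigcapP=> _ /imsetP[[i j] Dij ->].
  rewrite (@Hroot_blocks _ _ _ _ _ _ i j) ?(eqP (W1 _)) ?hD //=.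
  by rewrite -(eqP (W2 _)) permKV.
by move=> W; apply/eqP; rewrite eqEsubset !sub // Wequiv_sym.
Qed.

(** By [chi_value] the inner product factors into a sum T over L and a sum P over u^a. Inequivalent
    placements give P = 0; for equivalent ones the groups H_D coincide, the irreducible characters
    differ, and T = 0. *)
Lemma chi_orthogonal (alpha alpha' : charIndex F b) :
    rook_placement b (tag alpha) -> rook_placement b (tag alpha') ->
  ~~ char_equiv F b alpha alpha' -> '[chi eps alpha, chi eps alpha'] = 0.
Proof.
move=> rD rD' neq; pose D := tag alpha; pose D' := tag alpha'.
pose c : algC := #|GD F b D|%:R^-1 * #|ua|%:R^-1.
pose c' : algC := #|GD F b D'|%:R^-1 * #|ua|%:R^-1.
pose T := \sum_(h in Lset) 'chi_(tagged alpha) h * ('chi_(tagged alpha') h)^*.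
pose P := \sum_(X in ua) Phi D X * (Phi D' X)^*.
have e : \sum_g chi eps alpha g * (chi eps alpha' g)^* = c * c'^* * (T * P).
  rewrite big_LU /T mulr_suml mulr_sumr; apply: eq_bigr => h Lh.
  rewrite /P !mulr_sumr; apply: eq_bigr => X Xu.
  rewrite !chi_value // Lpart_LU // nilpart_LU // -/c -/c' !rmorphM.
  exact: mulr_regroup.
rewrite cfdotE (eq_bigl xpredT) => [|g]; last by rewrite inE.
rewrite [X in _ * X]e.
suff /eqP-> : T * P == 0 by rewrite !mulr0.
rewrite mulf_eq0; have [W | nW] := boolP (Wequiv b D D'); last first.
  by rewrite /P sum_Phi_eq0 ?eqxx ?orbT.
apply/orP; left; apply/eqP.
have [x nx] : exists x, 'chi_(tagged alpha) x != 'chi_(tagged alpha') x.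
  by move: neq; rewrite /char_equiv W /= negb_forall => /existsP.
rewrite -[RHS](@sum_irr_distinct _ _ _ (tagged alpha) (tagged alpha')); last by exists x.
  rewrite /T big_mkcond [RHS]big_mkcond; apply: eq_bigr => h _ /=.
  case: (boolP (h \in HD F b D)) => [/setIP[->//]|nh].
  by rewrite cfun0 // mul0r if_same.
by apply: val_inj; apply: HD_Wequiv W.
Qed.

End Supercharacters.

(** * Transversals and counting by fibres *)

Section Transversals.

Variables (T : finType) (R : rel T) (S X : {set T}).
Hypotheses (eqR : equivalence_rel R)
  (trX : is_transversal X (equivalence_partition R S) S).

Lemma eqv_transversal_sub : {subset X <= S}.
Proof. by case/and3P: trX => _ /subsetP. Qed.

Lemma eqv_transversal_meet x : x \in S -> #|X :&: [set y in S | R x y]| = 1%N.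
Proof.
by case/and3P: trX => _ _ /forall_inP H Sx; apply/eqP/H/imsetP; exists x.
Qed.

Lemma eqv_transversal_ex x : x \in S -> exists2 y, y \in X & R x y.
Proof.
move=> Sx; have /eqP/cards1P[y e] := eqv_transversal_meet Sx.
have : y \in X :&: [set y in S | R x y] by rewrite e set11.
by rewrite !inE => /and3P[Xy _ Rxy]; exists y.
Qed.

Lemma eqv_transversal_inj : {in X &, forall x y, R x y -> x = y}.
Proof.
move=> x y Xx Xy Rxy; have Sx := eqv_transversal_sub Xx.
have /eqP/cards1P[z e] := eqv_transversal_meet Sx.
have : x \in X :&: [set y in S | R x y] by rewrite !inE Xx Sx (eqR x x x).1.
have : y \in X :&: [set y in S | R x y] by rewrite !inE Xy (eqv_transversal_sub Xy) Rxy.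
by rewrite e !inE => /eqP-> /eqP->.
Qed.

End Transversals.

(** Each element lies over exactly one index of C, so either cardinal is the sum of its fibre
    sizes. *)
Lemma card_eq_fibers (I T1 T2 : finType) (C : {set I}) (A1 : {set T1}) (A2 : {set T2})
    (R1 : I -> pred T1) (R2 : I -> pred T2) :
    {in A1, forall x, #|[set i in C | R1 i x]| = 1%N} ->
    {in A2, forall x, #|[set i in C | R2 i x]| = 1%N} ->
    {in C, forall i, #|[set x in A1 | R1 i x]| = #|[set x in A2 | R2 i x]|} ->
  #|A1| = #|A2|.
Proof.
have count (T : finType) (B : {set T}) (R : I -> pred T) :
    {in B, forall x, #|[set i in C | R i x]| = 1%N} ->
    #|B| = (\sum_(i in C) #|[set x in B | R i x]|)%N.
  move=> fib1; rewrite -sum1_card (eq_bigr (fun x => \sum_(i in C | R i x) 1)%N).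
    rewrite (exchange_big_dep (mem C)) /=; last by move=> x i _ /andP[].
    apply: eq_bigr => i Ci; rewrite -sum1_card; apply: eq_bigl => x.
    by rewrite inE Ci.
  by move=> x Bx; rewrite sum1_card -[LHS](fib1 x Bx); apply: eq_card => i; rewrite inE.
move=> fib1 fib2 e; rewrite (count _ _ _ fib1) (count _ _ _ fib2).
exact: eq_bigr.
Qed.

Lemma uniq_image (T : finType) (U : eqType) (A : {set T}) (f : T -> U) :
  {in A &, injective f} -> uniq [seq f x | x in A].
Proof.
by move=> f_inj; rewrite map_inj_in_uniq ?enum_uniq // => x y; rewrite !mem_enum; apply: f_inj.
Qed.

Lemma pairwise_image (T : finType) (U : Type) (r : rel U) (A : {set T}) (f : T -> U) :
  {in A &, forall x y, x != y -> r (f x) (f y)} -> pairwise r [seq f x | x in A].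
Proof.
move=> rf; rewrite pairwise_map; have := enum_uniq (mem A); rewrite uniq_pairwise.
by apply: (@sub_in_pairwise _ (mem A)); last by apply/allP=> x; rewrite mem_enum.
Qed.

Lemma irr_set_eq (gT : finGroupType) (G H : {group gT}) (j : Iirr H) : G = H :> {set gT} ->
  exists i : Iirr G, 'chi_i =1 'chi_j.
Proof. by move/group_inj=> eGH; case: _ / eGH j => j; exists j. Qed.

Lemma subr_via (V : zmodType) (N a c : V) : a - c = N - c + - (N - a).
Proof. by rewrite opprB [RHS]addrC addrA subrK. Qed.

Lemma mul_orbits_sub (R : pzRingType) (P Q x y X x' X' y' : R) : P * x = 1 -> y * Q = 1 ->
  P * (x * X * y - x' * X' * y') * Q = X - P * x' * X' * (y' * Q).
Proof. by move=> Px yQ; rewrite mulrBr mulrBl !mulrA Px mul1r -[X * y * Q]mulrA yQ mulr1. Qed.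

(** * The sets K_beta partition the group *)

Section SuperclassPartition.

Variables (F : finFieldType) (n l : nat) (b : 'I_n.+1 -> 'I_l).
Hypothesis charF : 2%N \notin [pchar F].
Local Notation A := (gla F b).
Local Notation gT := {unit gla F b}.
Local Notation root := ('I_n.+1 * 'I_n.+1)%type.
Implicit Types (X Y Z : A) (g h x y : gT) (D : {set root}) (gam : root).
Local Notation Lset := (@Lset F n l b).
Local Notation ua := (@ua F n l b).
Local Notation X_ := (@X_ F n l b).

Lemma uval_mulVg x : uval x^-1%g * uval x = 1.
Proof. by rewrite -uvalM mulVg uval1. Qed.
Lemma uval_mulgV x : uval x * uval x^-1%g = 1.
Proof. by rewrite -uvalM mulgV uval1. Qed.

Lemma pi_eq h X Y : h \in Lset -> (pi_ h X == pi_ h Y) = (X - Y \in Jh h).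
Proof.
move=> Lh; rewrite /pi_ uhE //; apply/eqP/idP => [e | JXY].
  have : X \in [set X + Z | Z in Jh h] by apply/imsetP; exists 0; [apply: Jh0 | rewrite addr0].
  by rewrite e => /imsetP[Z JZ ->]; rewrite addrC addKr.
apply/setP=> Z; apply/imsetP/imsetP => -[V JV ->].
  by exists (X - Y + V); [apply: JhD | rewrite addrA [Y + _]addrC subrK].
exists (V - (X - Y)); first by apply: JhD => //; apply: JhN.
by rewrite opprB addrA [X + V]addrC -addrA [X + (_ - _)]addrC subrK addrC.
Qed.

Lemma K_P D h g : h \in Lset -> reflect
  ((Lpart g \in h ^: Lset)%g /\
     exists x y, nilpart g - uval x * X_ D * uval y \in Jh h) (g \in K_ (D, h)).
Proof.
move=> Lh; apply: (iffP mulsgP) => [[k u Ck Pu ->]|[CL [x [y J]]]].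
  have Lk : k \in Lset by case/imsetP: Ck => m Lm ->; apply: groupJ.
  move: Pu; rewrite inE uvalE => /setIdP[uu /imsetP[Y]].
  case/imset2P=> x y _ _ -> /eqP; rewrite pi_eq // !uvalE => J.
  have -> : u = Upart (uval u - 1) by apply: uval_inj; rewrite uval_Upart // addrC subrK.
  by rewrite Lpart_LU // nilpart_LU //; split=> //; exists x, y.
exists (Lpart g) (Upart (nilpart g)) => //; last exact: LU_partE.
rewrite inE uvalE uval_Upart ?nilpart_in // [1 + _]addrC addrK inE nilpart_in.
apply/imsetP; exists (uval x * X_ D * uval y); last by apply/eqP; rewrite pi_eq.
by apply/imset2P; exists x y; rewrite ?inE // !uvalE.
Qed.

Lemma class_pairsP D h :
  reflect (rook_placement b D /\ h \in HD F b D) ((D, h) \in class_pairs F b).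
Proof.
apply: (iffP idP) => [|[rD Hh]]; first by rewrite /class_pairs in_set => /andP[rD Hh]; split.
by rewrite /class_pairs in_set; apply/andP; split.
Qed.

Lemma class_L_Jh h k : h \in Lset -> k \in (h ^: Lset)%g -> Jh k = Jh h.
Proof. by move=> Lh /imsetP[m Lm ->]; rewrite Jh_conj. Qed.

(** For w in W_L this is a block diagonal unit; multiplication by such matrices realizes the action
    of W_L x W_L on X_D. *)
Definition perm_gla (w : 'S_n.+1) : A := Gla b (\matrix_(i, j) (i == w j)%:R).

Lemma mul_perm_gla (w : 'S_n.+1) X i j : w \in WL b -> (perm_gla w * X) (w i) j = X i j.
Proof.
rewrite inE => /forallP Ww; rewrite glaME big_mkcond (bigD1 i) //= big1 => [|s /negPf ne].
  by rewrite mxE eqxx mul1r addr0 (eqP (Ww _)) cyc_l.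
by rewrite mxE (inj_eq perm_inj) eq_sym ne mul0r if_same.
Qed.

Lemma mul_gla_perm (w : 'S_n.+1) X i j : w \in WL b -> (X * perm_gla w) i j = X i (w j).
Proof.
rewrite inE => /forallP Ww; rewrite glaME big_mkcond (bigD1 (w j)) //= big1 => [|s /negPf ne].
  by rewrite mxE eqxx mulr1 addr0 (eqP (Ww _)) cyc_r.
by rewrite mxE ne mulr0 if_same.
Qed.

Lemma perm_gla_unit (w : 'S_n.+1) : w \in WL b -> perm_gla w \is a GRing.unit.
Proof.
move=> Ww; have WV : (w^-1)%g \in WL b.
  move: Ww; rewrite !inE => /forallP Ww; apply/forallP=> i.
  by rewrite -(eqP (Ww _)) permKV.
apply/unitrP; exists (perm_gla (w^-1)%g); split; apply: glaP => i j.
  by rewrite mul_gla_perm // gla1E mxE permK.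
by rewrite -{1}(permKV w i) mul_perm_gla // gla1E mxE (inj_eq perm_inj).
Qed.

Lemma X_Wequiv D D' : Wequiv b D D' -> exists x y, X_ D' = uval x * X_ D * uval y.
Proof.
case/exists_inP=> w1 W1 /exists_inP[w2 W2 /eqP->].
exists (gla_unit (perm_gla w1)), (gla_unit (perm_gla w2)).
rewrite (uval_gla_unit (perm_gla_unit W1)) (uval_gla_unit (perm_gla_unit W2)).
apply: glaP => i j; rewrite -(permKV w1 i); move: ((w1^-1)%g i) => {}i.
rewrite (mul_gla_perm _ _ _ W2) (mul_perm_gla _ _ _ W1) !X_E.
congr (_%:R); congr nat_of_bool; apply/imsetP/idP => [[[p q] Dpq [/perm_inj-> ->]]|Dij].
  by rewrite permKV.
by exists (i, w2 j); rewrite //= permK.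
Qed.

Lemma K_class_equiv beta beta' g : beta \in class_pairs F b -> class_equiv F b beta beta' ->
  g \in K_ beta -> g \in K_ beta'.
Proof.
case: beta beta' => [D h] [D' h'] /class_pairsP[_ Hh] /andP[/= W C].
have Lh : h \in Lset by case/setIP: Hh.
have Lh' : h' \in Lset by case/imsetP: C => m Lm ->; apply: groupJ.
case/(K_P D g Lh)=> Cg [x [y J]]; apply/(K_P D' g Lh').
rewrite (class_L_Jh Lh C) (class_eqP C); split=> //.
have [x' [y' eX]] := X_Wequiv (Wequiv_sym W).
exists (x * x')%g, (y' * y)%g; rewrite !uvalM.
suff -> : uval x * uval x' * X_ D' * (uval y' * uval y) = uval x * X_ D * uval y by [].
by rewrite eX !mulrA.
Qed.

(** Coordinates of the nilpotent part at roots with h outside H_gam lie in [Jh h] and may be dropped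
    before the elimination. The roots of this kind in the resulting placement are dropped as well,
    which puts h in H_D'. *)
Lemma K_cover g : exists beta, beta \in class_pairs F b /\ g \in K_ beta.
Proof.
set h := Lpart g; have Lh : h \in Lset by apply: Lpart_in.
pose X : A := Gla b (\matrix_(i, j) (if h \in Hroot F b (i, j) then nilpart g i j else 0)).
have XE i j : X i j = if h \in Hroot F b (i, j) then nilpart g i j else 0 by rewrite mxE.
have Nu := nilpart_in g.
have Xu : X \in ua by apply/uaP=> i j e; rewrite XE (uaP _ Nu) ?if_same.
have JX : nilpart g - X \in Jh h.
  apply/JhP; split=> [|i j _ Hh]; last by rewrite glaBE XE Hh subrr.
  by apply: uaD => //; apply: uaN.
have [D [x [y [rD eX]]]] := rook_exists Xu.
pose D' := D :&: [set gam | h \in Hroot F b gam].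
have [Dr i1 i2] := rookP _ _ rD.
have rD' : rook_placement b D'.
  apply/rookP; split=> [gam /setIP[/Dr]//||].
    by move=> a a' /setIP[Da _] /setIP[Da' _]; apply: i1.
  by move=> a a' /setIP[Da _] /setIP[Da' _]; apply: i2.
have JD : X_ D - X_ D' \in Jh h.
  apply/JhP; split=> [|i j nij Hh]; first by apply: uaD; [|apply: uaN]; apply: X_ua.
  by rewrite glaBE !X_E in_setI in_set Hh andbT subrr.
exists (D', h); split.
  rewrite inE rD' in_setI Lh; apply/bigcapP=> gam /setIP[_].
  by rewrite in_set.
apply/(K_P D' g Lh); split; first exact: class_refl.
exists x, y; rewrite -[nilpart g](subrK X) -addrA; apply: JhD => //.
by rewrite eX -mulrBl -mulrBr; apply/Jh_mulr/Jh_mull.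
Qed.

Lemma K_disjoint beta beta' g : beta \in class_pairs F b -> beta' \in class_pairs F b ->
  g \in K_ beta -> g \in K_ beta' -> class_equiv F b beta beta'.
Proof.
case: beta beta' => [D h] [D' h'] /class_pairsP[rD Hh] /class_pairsP[rD' Hh'].
have Lh : h \in Lset by case/setIP: Hh.
have Lh' : h' \in Lset by case/setIP: Hh'.
case/(K_P D g Lh)=> C [x [y J]] /(K_P D' g Lh')[C' [x' [y' J']]].
have Chh' : (h' \in h ^: Lset)%g by rewrite -(class_eqP C) class_sym.
rewrite /class_equiv Chh' andbT.
have Hh'D : h \in HD F b D'.
  by case/imsetP: Chh' Hh' => m Lm ->; rewrite HD_conjE.
rewrite (class_L_Jh Lh Chh') in J'.
apply: (@orbit_Wequiv F _ _ _ h _ _ (x^-1 * x')%g (y' * y^-1)%g) => //.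
(* Subtracting the two congruences and cancelling x and y places X_D and X_D' in one orbit modulo
   [Jh h]. *)
have JJ := JhD J' (JhN J); rewrite -subr_via in JJ.
have := Jh_mulr (uval y^-1%g) (Jh_mull (uval x^-1%g) JJ).
by rewrite (mul_orbits_sub _ _ _ _ (uval_mulVg x) (uval_mulgV y)) -!uvalM.
Qed.

Lemma K_neq0 beta : beta \in class_pairs F b -> exists g, g \in K_ beta.
Proof.
case: beta => D h /class_pairsP[rD Hh]; have Lh : h \in Lset by case/setIP: Hh.
exists (h * Upart (X_ D))%g; have Xu := X_ua F rD; apply/(K_P D _ Lh).
rewrite Lpart_LU // nilpart_LU //; split; first exact: class_refl.
by exists 1%g, 1%g; rewrite uval1 mul1r mulr1 subrr Jh0.
Qed.

Lemma K_1 D h : D = set0 -> h = 1%g -> K_ (D, h) = [set 1%g : gT].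
Proof.
move=> -> ->; have L1 := group1 (L_group F b); apply/setP=> g; apply/(K_P set0 g L1)/set1P.
  have X0 : X_ set0 = 0 by rewrite /Defs.X_ big_set0.
  case=> /imsetP[m Lm]; rewrite conj1g => e [x [y]].
  rewrite X0 mulr0 mul0r subr0 Jh1 => /set1P e0.
  rewrite [g]LU_partE e e0 mul1g; apply: uval_inj.
  by rewrite uval_Upart ?ua0 // addr0 uval1.
move=> ->; rewrite Lpart_id // class_refl; split=> //; exists 1%g, 1%g.
rewrite /nilpart Lpart_id // mulVg uval1 subrr /Defs.X_ big_set0 mulr0 mul0r subr0.
exact: Jh0.
Qed.

End SuperclassPartition.

(** * Equality of the numbers of characters and classes *)

Section Counting.

Variables (F : finFieldType) (n l : nat) (b : 'I_n.+1 -> 'I_l).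
Local Notation gT := {unit gla F b}.
Local Notation root := ('I_n.+1 * 'I_n.+1)%type.
Implicit Types (D : {set root}).
Variables (cA : {set charIndex F b}) (cB : {set classIndex F b}).
Hypothesis hA : is_transversal cA
  (equivalence_partition (char_equiv F b) (char_pairs F b)) (char_pairs F b).
Hypothesis hB : is_transversal cB
  (equivalence_partition (class_equiv F b) (class_pairs F b)) (class_pairs F b).

(** Sending an irreducible character of H_D to the representative of its pair is a bijection: H_D is
    the same set for all equivalent placements, so every pair over the class of D is equivalent to
    one over D. *)
Lemma card_chars_over D : rook_placement b D ->
  #|[set alpha in cA | Wequiv b D (tag alpha)]| = #|classes (HD F b D)|.
Proof.
move=> rD; rewrite -NirrE -[RHS]card_ord -cardsT.
pose S := [set alpha in cA | Wequiv b D (tag alpha)].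
have ex (i : Iirr (HD F b D)) : exists2 alpha, alpha \in cA &
    char_equiv F b (Tagged (fun D => Iirr (HD F b D)) i) alpha.
  by apply: (eqv_transversal_ex hA); rewrite inE.
pose f i : charIndex F b := s2val (sig2W (ex i)).
have fA i : f i \in cA by rewrite /f; case: sig2W.
have fE i : char_equiv F b (Tagged (fun D => Iirr (HD F b D)) i) (f i).
  by rewrite /f; case: sig2W.
have f_inj : injective f.
  move=> i j e; apply: irr_inj; apply/cfunP=> g.
  have /andP[_ /forallP/(_ g)/eqP /= ->] := fE i.
  by rewrite e; have /andP[_ /forallP/(_ g)/eqP /= ->] := fE j.
rewrite -(card_imset _ f_inj); apply: eq_card => alpha; apply/idP/imsetP.
  case/setIdP=> Aa W.
  have [i ei] := irr_set_eq (tagged alpha) (HD_Wequiv F W).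
  exists i => //; apply: (eqv_transversal_inj (@char_equivP F n l b) hA) => //.
  have /andP[/= Wi /forallP ci] := fE i; apply/andP; split.
    exact: Wequiv_trans (Wequiv_sym W) Wi.
  by apply/forallP=> g; rewrite -ei; apply: ci.
by case=> i _ ->; rewrite inE fA; case/andP: (fE i).
Qed.

(** A representative (D', h) is sent to the L-class of h, which is a class of H_D by [HD_class]. *)
Lemma card_classes_over D : rook_placement b D ->
  #|[set beta in cB | Wequiv b D beta.1]| = #|classes (HD F b D)|.
Proof.
move=> rD; pose S := [set beta in cB | Wequiv b D beta.1].
have SP beta : beta \in S -> beta.2 \in HD F b D.
  case/setIdP=> /(eqv_transversal_sub hB); rewrite inE => /andP[_ H] W.
  by rewrite (HD_Wequiv F W).
have f_inj : {in S &, injective (fun beta : classIndex F b => (beta.2 ^: Lset F b)%g)}.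
  move=> beta beta' Sb Sb' e; apply: (eqv_transversal_inj (@class_equivP F n l b) hB).
  - by case/setIdP: Sb.
  - by case/setIdP: Sb'.
  rewrite /class_equiv e class_refl andbT.
  case/setIdP: Sb => _ W; case/setIdP: Sb' => _; apply: Wequiv_trans.
  exact: Wequiv_sym.
rewrite -(card_in_imset f_inj); apply: eq_card => C; apply/imsetP/imsetP.
  by case=> beta /SP Hh ->; exists beta.2 => //; apply: HD_class.
case=> h Hh ->; have [beta Bb] : exists2 beta, beta \in cB & class_equiv F b (D, h) beta.
  by apply: (eqv_transversal_ex hB); rewrite inE rD.
case/andP=> /= W C'; exists beta; first by rewrite inE Bb.
by rewrite -(HD_class Hh); apply/class_eqP; rewrite class_sym.
Qed.

(** Over each class of rook placements both fibres have as many elements as H_D has conjugacy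
    classes. *)
Lemma card_supercharacters : #|cA| = #|cB|.
Proof.
pose RP := [set D : {set root} | rook_placement b D].
have eqW : equivalence_rel (@Wequiv n l b).
  apply/equivalence_relP; split=> [D|D D' W E]; first exact: Wequiv_refl.
  by apply/idP/idP; apply: Wequiv_trans => //; apply: Wequiv_sym.
have trC := transversalP (equivalence_partitionP (in3W eqW) : partition _ RP).
set C := transversal _ _ in trC.
have fib D : D \in RP -> #|[set D' in C | Wequiv b D' D]| = 1%N.
  move=> RD; rewrite -(eqv_transversal_meet trC RD); apply: eq_card => D'.
  rewrite !inE; apply/andP/and3P => [[CD W]|[CD _ W]]; last by rewrite CD Wequiv_sym.
  by split=> //; [have := eqv_transversal_sub trC CD; rewrite inE | apply: Wequiv_sym].
apply: (@card_eq_fibers _ _ _ C _ _ (fun D alpha => Wequiv b D (tag alpha))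
  (fun D beta => Wequiv b D beta.1)).
- by move=> alpha /(eqv_transversal_sub hA) Sa; apply: fib; move: Sa; rewrite !inE.
- by move=> beta /(eqv_transversal_sub hB) Sb; apply: fib; move: Sb; rewrite !inE => /andP[].
move=> D /(eqv_transversal_sub trC); rewrite inE => rD.
by rewrite card_chars_over // card_classes_over.
Qed.

End Counting.

(** * Assembly of the supercharacter theory *)

Theorem theorem3p8 (F : finFieldType) (charF : 2%N \notin [pchar F])
  (eps : addchar F) (eps_nontrivial : exists t : F, eps t != 1)
  (n l : nat) (b : 'I_n.+1 -> 'I_l)
  (b_mono : {homo b : i j / (i <= j)%N})
  (b_onto : forall k : 'I_l, exists i : 'I_n.+1, b i = k)
  (cA : {set charIndex F b})
  (hA : is_transversal cA
          (equivalence_partition (char_equiv F b) (char_pairs F b))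
          (char_pairs F b))
  (cB : {set classIndex F b})
  (hB : is_transversal cB
          (equivalence_partition (class_equiv F b) (class_pairs F b))
          (class_pairs F b)) :
  supercharacter_theory (G := [set: {unit gla F b}]%G)
    [seq chi eps alpha | alpha in cA] [seq K_ beta | beta in cB].
Proof.
have rookA alpha : alpha \in cA -> rook_placement b (tag alpha).
  by move/(eqv_transversal_sub hA); rewrite inE.
have sB beta : beta \in cB -> beta \in class_pairs F b by move/(eqv_transversal_sub hB).
have injA := eqv_transversal_inj (@char_equivP F n l b) hA.
have injB := eqv_transversal_inj (@class_equivP F n l b) hB.
have disjK beta beta' g : beta \in cB -> beta' \in cB ->
    g \in K_ beta -> g \in K_ beta' -> beta = beta'.
  by move=> Bb Bb' Kg Kg'; apply: injB => //; apply: K_disjoint Kg Kg'; rewrite ?sB.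
split.
- split=> [chi0 /imageP[alpha Aa ->]|].
    by split; [apply: chi_char | apply: chi_neq0; rewrite ?rookA].
  apply: pairwise_image => alpha alpha' Aa Aa' ne.
  apply: cfdot_eq0_disjoint; try exact: chi_char.
  apply: chi_orthogonal; rewrite ?rookA //.
  by apply: contra ne => /injA->.
- split.
    apply: uniq_image => beta beta' Bb Bb' eK.
    have [g Kg] := K_neq0 charF (sB _ Bb).
    apply: (disjK _ _ g Bb Bb' Kg); rewrite -eK; exact: Kg.
  apply/and3P; split.
  + apply/eqP/setP=> g; rewrite inE; apply/bigcupP.
    have [beta [Pb Kg]] := K_cover charF g.
    have [beta' Bb' eq'] := eqv_transversal_ex hB Pb.
    exists (K_ beta'); first by rewrite inE; apply/imageP; exists beta'.
    exact: K_class_equiv Pb eq' Kg.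
  + apply/trivIsetP=> K K'; rewrite !inE => /imageP[beta Bb ->] /imageP[beta' Bb' ->] ne.
    apply/pred0P=> g /=; apply/negbTE/negP=> /andP[Kg Kg'].
    by case/eqP: ne; rewrite (disjK _ _ _ Bb Bb' Kg Kg').
  + rewrite inE; apply/imageP=> -[beta Bb e].
    by have [g] := K_neq0 charF (sB _ Bb); rewrite -e inE.
(* The identity class comes from the empty placement and h = 1; this pair is alone in its
   equivalence class, so the transversal contains it. *)
- have P1 : (set0, 1%g) \in class_pairs F b.
    apply/class_pairsP; split; last exact: group1.
    by apply/rookP; split=> gam; rewrite inE.
  have [[D h] Bb /andP[/= W C]] := eqv_transversal_ex hB P1.
  apply/imageP; exists (D, h) => //; rewrite K_1 //.
    by case/exists_inP: W => w1 _ /exists_inP[w2 _ /eqP->]; rewrite /Wact imset0.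
  by case/imsetP: C => m _ ->; rewrite conj1g.
- by rewrite !size_image; apply: card_supercharacters hA hB.
move=> chi0 K /imageP[alpha Aa ->] /imageP[[D h] Bb ->].
have [_ Hh] := class_pairsP _ _ (sB _ Bb); have Lh : h \in Lset F b by case/setIP: Hh.
(* Constancy follows from an expression of the value through D and h alone. *)
suff chiK g : g \in K_ (D, h) -> chi eps alpha g = #|GD F b (tag alpha)|%:R^-1 *
    #|ua F b|%:R^-1 * ('chi_(tagged alpha) h * Phi eps (tag alpha) (X_ F b D)).
  by move=> x y Kx Ky; rewrite !chiK.
case/(K_P charF _ _ Lh)=> /imsetP[m Lm eL] [x [y J]].
rewrite (chi_value eps_nontrivial _ (rookA _ Aa)) eL (HD_cfunJ _ _ Lm).
apply: (congr1 ( *%R _)).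
(* If h is outside the group H of [alpha], both sides vanish; otherwise [Phi] ignores [Jh h] and
   depends only on the orbit. *)
have [Hh' | nHh] := boolP (h \in HD F b (tag alpha)); last first.
  by rewrite (cfun0 _ nHh) [LHS]mul0r [RHS]mul0r.
apply: (congr1 ( *%R _)); rewrite -(Phi_orbit eps (tag alpha) (X_ F b D) x y).
by rewrite -[RHS](Phi_Jh eps _ (rookA _ Aa) Hh' J) [_ + (_ - _)]addrC subrK.
Qed.
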